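(* Let $s<0$ and $b\in\mathbb{R}$. Then the estimate $$\|u\|_{L^4_{txy}(\mathbb{R}\times\mathbb{R}\times\mathbb{T})}\lesssim\|u\|_{X_{s,b}}$$ fails; that is, there is no finite constant $C$ such that $\|u\|_{L^4_{txy}}\le C\|u\|_{X_{s,b}}$ holds for all $u\in X_{s,b}$.
   Context: $\mathbb{T}=\mathbb{R}/2\pi\mathbb{Z}$. Functions depend on $(t,x,y)\in\mathbb{R}\times\mathbb{R}\times\mathbb{T}$, with dual Fourier variables $(\tau,\xi,q)\in\mathbb{R}\times\mathbb{R}\times\mathbb{Z}$; $\hat f$ is the space-time Fourier transform. $\varphi(\xi,q)=\xi(\xi^2+q^2)$, $\langle z\rangle=(1+|z|^2)^{1/2}$ (Euclidean norm). For $s,b\in\mathbb{R}$, $X_{s,b}$ is defined by the norm $$\|f\|_{X_{s,b}}=\Big(\int_{\mathbb{R}}\int_{\mathbb{R}}\sum_{q\in\mathbb{Z}}\langle(\xi,q)\rangle^{2s}\langle\tau-\varphi(\xi,q)\rangle^{2b}|\hat f(\tau,\xi,q)|^2\,d\tau\,d\xi\Big)^{1/2}.$$ *)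

(* Defs.v *)
From HB Require Import structures.
From mathcomp Require Import all_boot all_order all_algebra.
From mathcomp Require Import complex.
From mathcomp Require Import all_classical all_reals all_analysis.

Set Implicit Arguments.
Unset Strict Implicit.
Unset Printing Implicit Defensive.

Import Order.TTheory GRing.Theory Num.Theory.
Import numFieldNormedType.Exports.
Import ComplexField.Normc.

Local Open Scope classical_set_scope.
Local Open Scope ring_scope.

(* A point ((t, x), y) of R * R * R stands for (t, x, y).  A function on
   R x R x T, where T is the reals modulo 2 pi, is a function on R * R * R of
   which only the values on the slab 0 <= y < 2 pi matter; smoothness on T is
   smoothness and 2 pi-periodicity in y. *)

Section Definitions.
Variable R : realType.
Implicit Types (f g : R * R * R -> R[i]) (s b : R).

Local Notation mu1 := (@lebesgue_measure R).
Local Notation mu2 := (mu1 \x mu1)%E.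
Local Notation mu3 := (mu1 \x mu1 \x mu1)%E.

Definition slab : set (R * R * R) := [set z | 0 <= z.2 < 2 * pi].

Definition cmeasurable d (X : measurableType d) (D : set X) (f : X -> R[i]) :=
  measurable_fun D (fun x => complex.Re (f x)) /\
  measurable_fun D (fun x => complex.Im (f x)).

Definition cintegral d (X : measurableType d)
    (mu : {measure set X -> \bar R}) (D : set X) (f : X -> R[i]) : R[i] :=
  ((\int[mu]_(x in D) complex.Re (f x))%R +i*
   (\int[mu]_(x in D) complex.Im (f x))%R)%C.

Definition cis (theta : R) : R[i] := (cos theta +i* sin theta)%C.

Definition axis (k : 'I_3) : R * R * R :=
  ((k == 0%N :> nat)%:R, (k == 1%N :> nat)%:R, (k == 2%N :> nat)%:R).

Definition partials (w : seq 'I_3) (h : R * R * R -> R) : R * R * R -> R :=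
  foldr (fun k h' => 'D_(axis k) h') h w.

Definition cpartials (w : seq 'I_3) f : R * R * R -> R[i] := fun z =>
  (partials w (fun z' => complex.Re (f z')) z +i*
   partials w (fun z' => complex.Im (f z')) z)%C.

(* The weight involves t and x only, since T is compact. *)
Definition weight (z : R * R * R) : R := 1 + z.1.1 ^+ 2 + z.1.2 ^+ 2.

Definition schwartz f : Prop :=
  [/\ (forall t x y, f (t, x, y + 2 * pi) = f (t, x, y)),
      (forall (w : seq 'I_3) (k : 'I_3) z,
         derivable (partials w (fun z' => complex.Re (f z'))) z (axis k) /\
         derivable (partials w (fun z' => complex.Im (f z'))) z (axis k)) &
      (forall (w : seq 'I_3) (m : nat), exists M : R, forall z,
         weight z ^+ m * normc (cpartials w f z) <= M)].

(* A tempered distribution is a linear functional on the Schwartz functions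
   that is bounded by finitely many Schwartz seminorms; its values outside the
   Schwartz functions are irrelevant and never used. *)
Record tempered_distribution := TemperedDistribution {
  pairing :> (R * R * R -> R[i]) -> R[i];
  pairing_linear : forall (a : R[i]) f g, schwartz f -> schwartz g ->
    pairing (fun z => a * f z + g z) = a * pairing f + pairing g;
  pairing_continuous : exists (m : nat) (C : R), forall f, schwartz f ->
    forall M : R,
      (forall (w : seq 'I_3) z, (size w <= m)%N ->
         weight z ^+ m * normc (cpartials w f z) <= M) ->
      normc (pairing f) <= C * M
}.

Implicit Type u : tempered_distribution.

Definition represents g u : Prop :=
  cmeasurable slab g /\
  forall f, schwartz f -> u f = cintegral mu3 slab (fun z => g z * f z).

(* Convention: the Fourier transform of f is the integral of
   f(t,x,y) exp(- i (t tau + x xi + y q)) dt dx dy. *)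
Definition fourier_mode (q : int) (psi : R * R -> R[i]) : R * R * R -> R[i] :=
  fun z => cintegral mu2 setT (fun w =>
    psi w * cis (- (z.1.1 * w.1 + z.1.2 * w.2 + z.2 * q%:~R))).

(* Schwartz functions of two variables are the Schwartz functions on R x R x T
   that do not depend on y. *)
Definition schwartz2 (psi : R * R -> R[i]) : Prop := schwartz (fun z => psi z.1).

(* The Fourier transform of u is the function F(tau, xi, q): by duality
   u(Fourier transform of Psi) = sum_q \int F Psi for the test functions
   Psi(tau, xi, q') = psi(tau, xi) 1_{q' = q}, whose finite sums are dense in
   the Schwartz functions on R x R x Z. *)
Definition is_fourier_transform (F : R * R -> int -> R[i]) u : Prop :=
  forall q : int,
    cmeasurable setT (fun w : measurableTypeR R * measurableTypeR R => F w q) /\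
    forall psi, schwartz2 psi ->
      u (fourier_mode q psi) = cintegral mu2 setT (fun w => F w q * psi w).

Definition phase (xi : R) (q : int) : R := xi * (xi ^+ 2 + q%:~R ^+ 2).

Definition jap (a : R) : R := Num.sqrt (1 + a ^+ 2).

Definition jap2 (a b : R) : R := Num.sqrt (1 + a ^+ 2 + b ^+ 2).

Definition weighted_norm s b (F : R * R -> int -> R[i]) : \bar R :=
  ((\int[mu1]_xi \int[mu1]_tau
      \esum_(q in [set: int])
        (jap2 xi q%:~R `^ (2 * s) * jap (tau - phase xi q) `^ (2 * b) *
         normc (F (tau, xi) q) ^+ 2)%R%:E) `^ 2^-1)%E.

(* A finite norm makes all the pairings above absolutely convergent, so in the
   infima below the members of the family at which the norm is finite are equal
   almost everywhere: the infimum is that common norm, and it is +oo if there is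
   no such member. *)
Definition Xnorm s b u : \bar R :=
  ereal_inf [set weighted_norm s b F | F in [set F | is_fourier_transform F u]].

Definition Xsb s b : set tempered_distribution :=
  [set u | (Xnorm s b u < +oo)%E].

Definition L4norm u : \bar R :=
  ereal_inf [set ((\int[mu3]_(z in slab) (normc (g z) ^+ 4)%R%:E) `^ 4^-1)%E
            | g in [set g | represents g u]].

End Definitions.

(* Main.v *)
(** The phase [phase xi n] equals [xi^3 + n^2 xi], so passing to the mode [n] only
    adds a transport term. Let [u_n (t, x, y) = e^(i n y) g(t) g(x + n^2 t)] with
    [g] the Gaussian. Its Fourier transform lives on the single mode [q = n],
    where it is [2 pi G(tau - n^2 xi) G(xi)], [G] being the transform of [g].
    Since [tau - phase xi n = (tau - n^2 xi) - xi^3], the factor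
    [<tau - phase>^(2 b)] is controlled by [G] uniformly in [n], whereas
    [<(xi, n)>^(2 s) <= n^(2 s)]; hence the X_{s,b} norm of [u_n] is [O(n^s)].
    The L^4 norm does not see the shear [x + n^2 t] and stays bounded below.

    As a distribution, [u_n] is written in the sheared variables [(t, x + n^2 t)],
    which makes its Fourier transform a product of one-dimensional integrals.
    The lower bound on the L^4 norm of any representative is obtained by testing
    against the conjugate of [u_n]. *)

(* Both norms are infima over representatives, and this decides what each side requires: a single
   explicit transform bounds the X_{s,b} norm from above, whereas the L^4 bound must hold for every
   [g] representing the distribution, so it goes through duality instead of any uniqueness
   statement. Since b is arbitrary, the modulation weight may grow like any power of [tau - n^2 xi]
   and of [xi]. A Gaussian profile suits this: its transform decays faster than every power, which
   integration by parts shows without a closed form, and its derivatives are polynomials times a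
   Gaussian, so that the Schwartz bounds of the test function are explicit. Schwartz functions are
   specified only by derivatives along the axes, so their measurability, which every use of Fubini
   requires, has to be derived. *)
From HB Require Import structures.
Require Import Defs.
From mathcomp Require Import all_boot all_order all_algebra.
From mathcomp Require Import complex ring lra.
From mathcomp Require Import all_classical all_reals all_analysis.
From mathcomp Require Import measurable_realfun.

Set Implicit Arguments.
Unset Strict Implicit.
Unset Printing Implicit Defensive.

Import Order.TTheory GRing.Theory Num.Theory.
Import numFieldNormedType.Exports.
Import ComplexField.Normc.

Local Open Scope classical_set_scope.
Local Open Scope ring_scope.

(** * Integration of complex-valued functions *)

Section SigmaFiniteProduct.
Context d1 d2 (T1 : measurableType d1) (T2 : measurableType d2) (R : realType).
Variables (m1 : {sigma_finite_measure set T1 -> \bar R})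
          (m2 : {sigma_finite_measure set T2 -> \bar R}).

(* The library attaches the sigma-finite structure of a product only to
   products of probabilities, hence this copy of the product measure. *)
Definition sfprod : set (T1 * T2)%type -> \bar R := (m1 \x m2)%E.

HB.instance Definition _ := Measure.on sfprod.

Lemma sigma_finite_sfprod : sigma_finite setT sfprod.
Proof.
have [F [FT Fnd Ffin]] := (sigma_finiteP setT m1).1 (sigma_finiteT m1).
have [G [GT Gnd Gfin]] := (sigma_finiteP setT m2).1 (sigma_finiteT m2).
exists (fun n => F n `*` G n) => [|n].
  apply/esym/seteqP; split=> // -[x y] _.
  have [i _ Fx] : (\bigcup_i F i) x by rewrite -FT.
  have [j _ Gy] : (\bigcup_i G i) y by rewrite -GT.
  exists (maxn i j) => //; split => /=.
  - by have /subsetPset := Fnd _ _ (leq_maxl i j); apply.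
  - by have /subsetPset := Gnd _ _ (leq_maxr i j); apply.
have [mF Foo] := Ffin n; have [mG Goo] := Gfin n.
split; first exact: measurableX.
by rewrite /sfprod product_measure1E// lte_mul_pinfty// ge0_fin_numE.
Qed.

HB.instance Definition _ :=
  Measure_isSigmaFinite.Build _ _ _ sfprod sigma_finite_sfprod.

End SigmaFiniteProduct.

Section ComplexMeasurable.
Context d (X : measurableType d) (R : realType).
Implicit Types (f g : X -> R[i]) (h : X -> R).

Lemma cmeasurableM D f g : cmeasurable D f -> cmeasurable D g ->
  cmeasurable D (fun x => f x * g x).
Proof.
move=> [fr fi] [gr gi]; split.
- rewrite [X in measurable_fun _ X](_ : _ = fun x =>
    complex.Re (f x) * complex.Re (g x) - complex.Im (f x) * complex.Im (g x)).
    by apply: measurable_funB; apply: measurable_funM.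
  by apply/funext => x; case: (f x) (g x) => ? ? [].
- rewrite [X in measurable_fun _ X](_ : _ = fun x =>
    complex.Re (f x) * complex.Im (g x) + complex.Im (f x) * complex.Re (g x)).
    by apply: measurable_funD; apply: measurable_funM.
  by apply/funext => x; case: (f x) (g x) => ? ? [].
Qed.

Lemma cmeasurable_real D h : measurable_fun D h ->
  cmeasurable D (fun x => (h x)%:C%C).
Proof. by move=> mh; split => //=; exact: measurable_cst. Qed.

Lemma cmeasurable_cst (D : set X) (c : R[i]) : cmeasurable D (fun _ => c).
Proof. by split; exact: measurable_cst. Qed.

Lemma cmeasurable_cis D h : measurable_fun D h ->
  cmeasurable D (fun x => cis (h x)).
Proof.
move=> mh; split => /=.
- apply: (measurableT_comp (f := @cos R)) => //.
  by apply: continuous_measurable_fun; exact: continuous_cos.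
- apply: (measurableT_comp (f := @sin R)) => //.
  by apply: continuous_measurable_fun; exact: continuous_sin.
Qed.

Lemma cmeasurable_comp d' (Y : measurableType d') (k : Y -> X) f :
  cmeasurable setT f -> measurable_fun setT k ->
  cmeasurable setT (fun y => f (k y)).
Proof.
move=> [fr fi] mk; split.
- exact: (measurableT_comp (f := fun x => complex.Re (f x))).
- exact: (measurableT_comp (f := fun x => complex.Im (f x))).
Qed.

Lemma Re_le_normc (a : R[i]) : `|complex.Re a| <= normc a.
Proof.
by case: a => a b /=; rewrite -sqrtr_sqr ler_sqrt ?addr_ge0 ?sqr_ge0// lerDl sqr_ge0.
Qed.

Lemma Im_le_normc (a : R[i]) : `|complex.Im a| <= normc a.
Proof.
by case: a => a b /=; rewrite -sqrtr_sqr ler_sqrt ?addr_ge0 ?sqr_ge0// lerDr sqr_ge0.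
Qed.

Lemma normc_le_ReIm (a : R[i]) : normc a <= `|complex.Re a| + `|complex.Im a|.
Proof.
case: a => a b /=; rewrite -[leRHS]ger0_norm ?addr_ge0// -sqrtr_sqr.
rewrite ler_sqrt ?sqr_ge0// sqrrD !real_normK ?num_real//.
by rewrite addrAC lerDl mulrn_wge0// mulr_ge0.
Qed.

Lemma normc_real (r : R) : normc r%:C%C = `|r|.
Proof. by rewrite /= expr0n addr0 sqrtr_sqr. Qed.

Lemma normc_ge0 (a : R[i]) : 0 <= normc a.
Proof. by case: a => a b /=; exact: sqrtr_ge0. Qed.

Lemma normc_cis (t : R) : normc (cis t) = 1.
Proof. by rewrite /= cos2Dsin2 sqrtr1. Qed.

Lemma cisD (s t : R) : cis (s + t) = cis s * cis t.
Proof. by apply/eqP; rewrite eq_complex /= cosD sinD eqxx addrC eqxx. Qed.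

Lemma cmeasurable_normc D f : measurable D -> cmeasurable D f ->
  measurable_fun D (fun x => normc (f x)).
Proof.
move=> mD [fr fi].
rewrite (_ : (fun x => _) = fun x =>
    Num.sqrt (complex.Re (f x) ^+ 2 + complex.Im (f x) ^+ 2)).
  apply: (measurableT_comp (f := @Num.sqrt R)) => //.
    exact: continuous_measurable_fun (@sqrt_continuous R).
  by apply: measurable_funD; exact: measurable_funX.
by apply/funext => x; case: (f x).
Qed.

End ComplexMeasurable.

Section ComplexIntegral.
Context d (X : measurableType d) (R : realType) (mu : {measure set X -> \bar R}).
Implicit Types (f g : X -> R[i]) (h : X -> R).

Definition cintegrable f :=
  mu.-integrable setT (fun x => (complex.Re (f x))%:E) /\
  mu.-integrable setT (fun x => (complex.Im (f x))%:E).

Lemma cintegrable_le f h : cmeasurable setT f ->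
  mu.-integrable setT (fun x => (h x)%:E) -> (forall x, normc (f x) <= h x) ->
  cintegrable f.
Proof.
move=> [fr fi] ih fh; split; apply: (le_integrable _ _ _ ih) => //.
- exact/measurable_EFinP.
- move=> x _ /=; rewrite lee_fin (le_trans (Re_le_normc _))//.
  by rewrite (le_trans (fh _))// ler_norm.
- exact/measurable_EFinP.
- move=> x _ /=; rewrite lee_fin (le_trans (Im_le_normc _))//.
  by rewrite (le_trans (fh _))// ler_norm.
Qed.

Lemma eq_cintegral D f g : (forall x, D x -> f x = g x) ->
  cintegral mu D f = cintegral mu D g.
Proof.
move=> fg; rewrite /cintegral; congr (_ +i* _)%C.
- by apply: eq_Rintegral => x; rewrite inE => Dx; rewrite fg.
- by apply: eq_Rintegral => x; rewrite inE => Dx; rewrite fg.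
Qed.

Lemma cintegral_mkcond D f :
  cintegral mu D f = cintegral mu setT (fun x => (\1_D x)%:C%C * f x).
Proof.
rewrite /cintegral Rintegral_mkcond [X in (_ +i* X)%C]Rintegral_mkcond.
by congr (_ +i* _)%C; apply: eq_Rintegral => x _; rewrite patchE indicE;
  case: (f x) => a b; case: (x \in D) => /=; rewrite ?mul1r ?mul0r ?subr0 ?addr0.
Qed.

Lemma cintegral_linear (a : R[i]) f g : cintegrable f -> cintegrable g ->
  cintegral mu setT (fun x => a * f x + g x) =
  a * cintegral mu setT f + cintegral mu setT g.
Proof.
move=> [fr fi] [gr gi]; case: a => a b; rewrite /cintegral /=.
have Z (c : R) (k : X -> R) : mu.-integrable setT (EFin \o k) ->
    mu.-integrable setT (EFin \o (fun x => c * k x)).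
  by move=> ik; have := integrableZl measurableT c ik; apply: eq_integrable.
have D (k l : X -> R) : mu.-integrable setT (EFin \o k) ->
    mu.-integrable setT (EFin \o l) ->
    mu.-integrable setT (EFin \o (fun x => k x + l x)).
  by move=> ik il; have := integrableD measurableT ik il; apply: eq_integrable.
have B (k l : X -> R) : mu.-integrable setT (EFin \o k) ->
    mu.-integrable setT (EFin \o l) ->
    mu.-integrable setT (EFin \o (fun x => k x - l x)).
  by move=> ik il; have := integrableB measurableT ik il; apply: eq_integrable.
apply/eqP; rewrite eq_complex /=; apply/andP; split; apply/eqP.
- rewrite -!RintegralZl// -RintegralB//; [|exact: Z|exact: Z].
  rewrite -RintegralD//; last by apply: B; exact: Z.
  by apply: eq_Rintegral => x _; case: (f x) (g x) => ? ? [].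
- rewrite -!RintegralZl// -RintegralD//; [|exact: Z|exact: Z].
  rewrite -RintegralD//; last by apply: D; exact: Z.
  by apply: eq_Rintegral => x _; case: (f x) (g x) => ? ? [].
Qed.

Lemma cintegralZl (a : R[i]) f : cintegrable f ->
  cintegral mu setT (fun x => a * f x) = a * cintegral mu setT f.
Proof.
move=> cf; have c0 : cintegrable (fun=> 0).
  by split; exact: integrable0.
have := cintegral_linear a cf c0.
rewrite [X in _ = _ + X -> _](_ : _ = 0); last first.
  by rewrite /cintegral /= /Rintegral !integral0.
rewrite addr0 => <-.
by apply: eq_cintegral => x _; rewrite addr0.
Qed.

(** The real and imaginary parts are each bounded by the integral of [h], hence the factor 2. *)
Lemma normc_cintegral_le f h : cmeasurable setT f ->
  mu.-integrable setT (fun x => (h x)%:E) -> (forall x, normc (f x) <= h x) ->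
  normc (cintegral mu setT f) <= 2 * (\int[mu]_x h x)%R.
Proof.
move=> mf ih fh; have [fr fi] := cintegrable_le mf ih fh.
rewrite (le_trans (normc_le_ReIm _))// mulr2n mulrDl !mul1r /=; apply: lerD.
- rewrite (le_trans (le_normr_Rintegral _ _))//; apply: le_Rintegral => //.
    by have := integrable_abse fr; apply: eq_integrable.
  by move=> x _; rewrite (le_trans (Re_le_normc _)).
- rewrite (le_trans (le_normr_Rintegral _ _))//; apply: le_Rintegral => //.
    by have := integrable_abse fi; apply: eq_integrable.
  by move=> x _; rewrite (le_trans (Im_le_normc _)).
Qed.

End ComplexIntegral.

(** * Fubini for kernels dominated by a tensor product *)

Section Fubini.
Context d1 d2 (T1 : measurableType d1) (T2 : measurableType d2) (R : realType).
Variables (m1 : {sigma_finite_measure set T1 -> \bar R})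
          (m2 : {sigma_finite_measure set T2 -> \bar R}).

Lemma ge0_integral_tensor (h1 : T1 -> R) (h2 : T2 -> R) :
  measurable_fun setT h1 -> measurable_fun setT h2 ->
  (forall x, 0 <= h1 x) -> (forall y, 0 <= h2 y) ->
  (\int[m1 \x m2]_z (h1 z.1 * h2 z.2)%:E =
   \int[m1]_x (h1 x)%:E * \int[m2]_y (h2 y)%:E)%E.
Proof.
move=> mh1 mh2 h10 h20.
rewrite fubini_tonelli1//=; last 2 first.
- apply/measurable_EFinP/measurable_funM.
  + exact: (measurableT_comp mh1 measurable_fst).
  + exact: (measurableT_comp mh2 measurable_snd).
- by move=> z; rewrite lee_fin mulr_ge0.
rewrite /fubini_F /=.
transitivity (\int[m1]_x ((h1 x)%:E * \int[m2]_y (h2 y)%:E))%E.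
  apply: eq_integral => x _; rewrite -ge0_integralZl ?lee_fin//.
  - exact/measurable_EFinP.
  - by move=> y _; rewrite lee_fin.
rewrite ge0_integralZr//; first exact/measurable_EFinP.
- by move=> y _; rewrite lee_fin.
- by apply: integral_ge0 => y _; rewrite lee_fin.
Qed.

Lemma integrable_tensor (h1 : T1 -> R) (h2 : T2 -> R) :
  m1.-integrable setT (fun x => (h1 x)%:E) ->
  m2.-integrable setT (fun y => (h2 y)%:E) ->
  (m1 \x m2)%E.-integrable setT (fun z => (h1 z.1 * h2 z.2)%:E).
Proof.
move=> /integrableP[/measurable_EFinP mh1 ih1] /integrableP[/measurable_EFinP mh2 ih2].
apply/integrableP; split.
  apply/measurable_EFinP/measurable_funM.
  - exact: (measurableT_comp mh1 measurable_fst).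
  - exact: (measurableT_comp mh2 measurable_snd).
under eq_integral => z _ do rewrite /= normrM.
rewrite (ge0_integral_tensor (h1 := fun x => `|h1 x|) (h2 := fun y => `|h2 y|))//.
- by rewrite lte_mul_pinfty// ?integral_ge0// ge0_fin_numE// integral_ge0.
- exact: measurableT_comp.
- exact: measurableT_comp.
Qed.

Section Dominated.
Variables (k : T1 * T2 -> R) (h1 : T1 -> R) (h2 : T2 -> R).
Hypothesis mk : measurable_fun setT k.
Hypothesis ih1 : m1.-integrable setT (fun x => (h1 x)%:E).
Hypothesis ih2 : m2.-integrable setT (fun y => (h2 y)%:E).
Hypothesis kh : forall x y, `|k (x, y)| <= h1 x * h2 y.

Lemma integrable_dominated_tensor : (m1 \x m2)%E.-integrable setT (fun z => (k z)%:E).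
Proof.
apply: (le_integrable _ _ _ (integrable_tensor ih1 ih2)) => //.
- exact/measurable_EFinP.
- by move=> [x y] _ /=; rewrite lee_fin (le_trans (kh _ _))// ler_norm.
Qed.

(** The domination holds at every point, so every section is integrable and not just almost every
    one. The inner integrals are then finite everywhere, which lets [fine] pass through the iterated
    integral. *)
Lemma integrable_section1 x : m2.-integrable setT (fun y => (k (x, y))%:E).
Proof.
have := integrableZl measurableT (h1 x) ih2; apply: le_integrable => //.
- by apply/measurable_EFinP; exact: measurable_fun_pair2.
- by move=> y _ /=; rewrite lee_fin (le_trans (kh _ _))// ler_norm.
Qed.

Lemma integrable_section2 y : m1.-integrable setT (fun x => (k (x, y))%:E).
Proof.
have := integrableZr measurableT (h2 y) ih1; apply: le_integrable => //.
- by apply/measurable_EFinP; exact: measurable_fun_pair1.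
- by move=> x _ /=; rewrite lee_fin (le_trans (kh _ _))// ler_norm.
Qed.

Lemma Rintegral_fubini1 :
  (\int[m1]_x \int[m2]_y k (x, y) = \int[(m1 \x m2)%E]_z k z)%R.
Proof.
rewrite /Rintegral -(integral12_prod_meas1 integrable_dominated_tensor).
congr fine; apply: eq_integral => x _; rewrite fineK//.
exact: integrable_fin_num (integrable_section1 x).
Qed.

Lemma Rintegral_fubini2 :
  (\int[m2]_y \int[m1]_x k (x, y) = \int[(m1 \x m2)%E]_z k z)%R.
Proof.
rewrite /Rintegral -(integral21_prod_meas1 integrable_dominated_tensor).
congr fine; apply: eq_integral => y _; rewrite fineK//.
exact: integrable_fin_num (integrable_section2 y).
Qed.

End Dominated.

Section ComplexDominated.
Variables (k : T1 * T2 -> R[i]) (h1 : T1 -> R) (h2 : T2 -> R).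
Hypothesis mk : cmeasurable setT k.
Hypothesis ih1 : m1.-integrable setT (fun x => (h1 x)%:E).
Hypothesis ih2 : m2.-integrable setT (fun y => (h2 y)%:E).
Hypothesis kh : forall x y, normc (k (x, y)) <= h1 x * h2 y.

Let kr x y : `|complex.Re (k (x, y))| <= h1 x * h2 y.
Proof. exact: le_trans (Re_le_normc _) (kh _ _). Qed.

Let ki x y : `|complex.Im (k (x, y))| <= h1 x * h2 y.
Proof. exact: le_trans (Im_le_normc _) (kh _ _). Qed.

Lemma cintegral_fubini1 :
  cintegral m1 setT (fun x => cintegral m2 setT (fun y => k (x, y))) =
  cintegral (m1 \x m2)%E setT k.
Proof.
rewrite /cintegral /=; congr (_ +i* _)%C.
- exact: (Rintegral_fubini1 mk.1 ih1 ih2 kr).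
- exact: (Rintegral_fubini1 mk.2 ih1 ih2 ki).
Qed.

Lemma cintegral_fubini :
  cintegral m1 setT (fun x => cintegral m2 setT (fun y => k (x, y))) =
  cintegral m2 setT (fun y => cintegral m1 setT (fun x => k (x, y))).
Proof.
rewrite cintegral_fubini1 /cintegral /=; congr (_ +i* _)%C.
- exact/esym/(Rintegral_fubini2 mk.1 ih1 ih2 kr).
- exact/esym/(Rintegral_fubini2 mk.2 ih1 ih2 ki).
Qed.

End ComplexDominated.

Lemma cintegral_tensor (f : T1 -> R[i]) (g : T2 -> R[i])
    (h1 : T1 -> R) (h2 : T2 -> R) :
  cmeasurable setT f -> cmeasurable setT g ->
  m1.-integrable setT (fun x => (h1 x)%:E) ->
  m2.-integrable setT (fun y => (h2 y)%:E) ->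
  (forall x, normc (f x) <= h1 x) -> (forall y, normc (g y) <= h2 y) ->
  cintegral (m1 \x m2)%E setT (fun z => f z.1 * g z.2) =
  cintegral m1 setT f * cintegral m2 setT g.
Proof.
move=> mf mg ih1 ih2 fh gh.
rewrite -(cintegral_fubini1 _ ih1 ih2)/=; last 2 first.
- apply: cmeasurableM.
  + exact: cmeasurable_comp mf measurable_fst.
  + exact: cmeasurable_comp mg measurable_snd.
- by move=> x y; rewrite normcM; apply: ler_pM => //; exact: normc_ge0.
rewrite mulrC -cintegralZl; last exact: cintegrable_le fh.
apply: eq_cintegral => x _.
rewrite mulrC cintegralZl//; exact: cintegrable_le gh.
Qed.

End Fubini.

(** * Measurability of Schwartz functions *)

Section SchwartzMeasurable.
Variable R : realType.
Local Notation mR := (measurableTypeR R).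
Local Notation V := (R * R * R)%type.

(** Both difference quotients are the same function of the increment. This brings the one-variable
    mean value theorem and chain rule to derivatives along an axis. *)
Lemma is_derive_line (h : V -> R) (z v : V) (s d : R) :
  is_derive (s *: v + z) v h d <-> is_derive s 1 (fun r : R => h (r *: v + z)) d.
Proof.
have E : (fun r : R => r^-1 *: ((h \o shift (s *: v + z)) (r *: v) - h (s *: v + z))) =
    (fun r : R => r^-1 *: (((fun r : R => h (r *: v + z)) \o shift s) (r *: 1) - h (s *: v + z))).
  apply/funext => r /=; congr (_ *: (h _ - _)).
  by rewrite addrA -scalerDl -[r%:A]/(r * 1) mulr1.
have E1 : derivable h (s *: v + z) v = derivable (fun r : R => h (r *: v + z)) s 1.
  by rewrite /derivable E.
have E2 : 'D_v h (s *: v + z) = 'D_1 (fun r : R => h (r *: v + z)) s.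
  by rewrite /derive E.
split=> -[d1 d2]; constructor.
- by rewrite -E1.
- by rewrite -E2.
- by rewrite E1.
- by rewrite E2.
Qed.

Lemma axisE (k : 'I_3) (r t x y : R) : r *: axis R k + (t, x, y) =
  (r * (k == 0%N :> nat)%:R + t, r * (k == 1%N :> nat)%:R + x,
   r * (k == 2%N :> nat)%:R + y).
Proof. by []. Qed.

Lemma axis_lipschitz (h : V -> R) (k : 'I_3) (M : R) :
  (forall z, derivable h z (axis R k)) ->
  (forall z, `|'D_(axis R k) h z| <= M) ->
  forall z r, `|h (r *: axis R k + z) - h z| <= M * `|r|.
Proof.
move=> dh Mh z.
have D (s : R) : is_derive s 1 (fun r : R => h (r *: axis R k + z))
    ('D_(axis R k) h (s *: axis R k + z)).
  by apply/is_derive_line; exact: derivableP.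
have C : continuous (fun r : R => h (r *: axis R k + z)).
  by move=> s; apply/differentiable_continuous/derivable1_diffP.
have P a b : a < b -> `|h (b *: axis R k + z) - h (a *: axis R k + z)| <= M * (b - a).
  move=> ab.
  have [|c _ ->] := @MVT R _ _ _ _ ab (fun s _ => D s).
    exact: continuous_subspaceT.
  by rewrite normrM [X in _ * X]gtr0_norm ?subr_gt0// ler_wpM2r// subr_ge0 ltW.
move=> r; have [r0|r0|->] := ltgtP r 0.
- by have := P _ _ r0; rewrite scale0r add0r distrC sub0r (ltr0_norm r0).
- by have := P _ _ r0; rewrite scale0r add0r subr0 (gtr0_norm r0).
- by rewrite scale0r add0r subrr normr0 mulr0.
Qed.

(** Each superlevel set is a countable union of rational boxes, which are measurable for the product
    sigma-algebra. *)
Lemma lipschitz_measurable (h : V -> R) (L : R) : 0 < L ->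
  (forall t x y t' x' y',
     `|h (t, x, y) - h (t', x', y')| <= L * (`|t - t'| + `|x - x'| + `|y - y'|)) ->
  measurable_fun setT (h : mR * mR * mR -> R).
Proof.
move=> L0 Lh; apply: (measurability _ (RGenOInfty.measurableE R)) => _ [_ [c ->] <-].
rewrite setTI.
(* On a box of half-side [r] the Lipschitz bound lets [h] vary by at most [3 L r] from its value at
   the centre, so the test at the centre forces [h > c] on the whole box. *)
pose box (q : rat * rat * rat * rat) : set (mR * mR * mR) :=
  let: (q1, q2, q3, r) := q in
  if c < h (ratr q1, ratr q2, ratr q3) - 3 * L * ratr r then
  `](ratr q1 - ratr r), (ratr q1 + ratr r)[ `*`
  `](ratr q2 - ratr r), (ratr q2 + ratr r)[ `*`
  `](ratr q3 - ratr r), (ratr q3 + ratr r)[ else set0.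
suff -> : h @^-1` `]c, +oo[%classic = \bigcup_q box q.
  apply: countable_bigcupT_measurable => [|[[[q1 q2] q3] r]]; first exact: countableP.
  by rewrite /box; case: ifP => // _; do 2 apply: measurableX => //.
apply/seteqP; split=> [[[t x] y] /=|[[t x] y] [[[[q1 q2] q3] r] _]].
- rewrite in_itv /= andbT => ch.
  (* The margin is spent twice: [3 L r] to compare the point with a rational centre and [3 L r] in
     the test defining [box], hence the factor 6. *)
  pose e := (h (t, x, y) - c) / (6 * L).
  have e0 : 0 < e by rewrite divr_gt0 ?subr_gt0// mulr_gt0.
  have [r /itvP rP] := rat_in_itvoo e0.
  have r0 : 0 < ratr r :> R by rewrite rP.
  have A (a : R) : a - ratr r < a + ratr r by lra.
  have [q1 /itvP Q1] := rat_in_itvoo (A t).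
  have [q2 /itvP Q2] := rat_in_itvoo (A x).
  have [q3 /itvP Q3] := rat_in_itvoo (A y).
  exists (q1, q2, q3, r) => //; rewrite /box.
  have N (a b : R) : a - ratr r < b -> b < a + ratr r -> `|a - b| <= ratr r.
    by move=> ? ?; rewrite ler_norml; lra.
  have := Lh t x y (ratr q1) (ratr q2) (ratr q3).
  have S : `|t - ratr q1| + `|x - ratr q2| + `|y - ratr q3| <= 3 * ratr r.
    have := N t (ratr q1); have := N x (ratr q2); have := N y (ratr q3).
    rewrite !Q1 !Q2 !Q3 => /(_ isT isT) ? /(_ isT isT) ? /(_ isT isT) ?; lra.
  move=> /le_trans/(_ (ler_wpM2l (ltW L0) S)); rewrite ler_norml => /andP[_ hq].
  have re : ratr r * (6 * L) < h (t, x, y) - c.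
    by rewrite -ltr_pdivlMr ?mulr_gt0// rP.
  rewrite ifT; last by nra.
  have := (rP, Q1, Q2, Q3); split; first split; rewrite /= in_itv /=; apply/andP; split;
   rewrite ?ltrBlDr ?Q1 ?Q2 ?Q3// -ltrBlDr ?Q1 ?Q2 ?Q3//.
- rewrite /box; case: ifP => // ch [[/=]]; rewrite !in_itv /= => t1 x1 y1.
  rewrite andbT (lt_le_trans ch)//.
  have N (a b : R) : (b - ratr r < a < b + ratr r) -> `|a - b| <= ratr r.
    by move=> /andP[? ?]; rewrite ler_norml; lra.
  have := Lh t x y (ratr q1) (ratr q2) (ratr q3).
  have S : `|t - ratr q1| + `|x - ratr q2| + `|y - ratr q3| <= 3 * ratr r.
    by have := N _ _ t1; have := N _ _ x1; have := N _ _ y1; lra.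
  move=> /le_trans/(_ (ler_wpM2l (ltW L0) S)); rewrite ler_norml => /andP[hq _].
  nra.
Qed.

(** Moving one coordinate at a time turns bounds along the three axes into a Lipschitz bound for the
    sum of the coordinate distances. *)
Lemma bounded_partials_measurable (h : V -> R) (M : R) :
  (forall (k : 'I_3) z, derivable h z (axis R k)) ->
  (forall (k : 'I_3) z, `|'D_(axis R k) h z| <= M) ->
  measurable_fun setT (h : mR * mR * mR -> R).
Proof.
move=> dh Mh.
have M0 : 0 <= M by apply: le_trans (Mh ord0 0).
(* [M] may be zero, while the Lipschitz constant has to be positive. *)
apply: (@lipschitz_measurable _ (M + 1)) => [|t x y t' x' y']; first lra.
have P k := axis_lipschitz (dh k) (Mh k).
have X : `|h (t, x, y) - h (t', x, y)| <= M * `|t - t'|.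
  have := P 0 (t', x, y) (t - t').
  by rewrite axisE /= !mulr0 !add0r mulr1 subrK.
have Y : `|h (t', x, y) - h (t', x', y)| <= M * `|x - x'|.
  have := P 1 (t', x', y) (x - x').
  by rewrite axisE /= !mulr0 !add0r mulr1 subrK.
have Z : `|h (t', x', y) - h (t', x', y')| <= M * `|y - y'|.
  have := P 2 (t', x', y') (y - y').
  by rewrite axisE /= !mulr0 !add0r mulr1 subrK.
have T : `|h (t, x, y) - h (t', x', y')| <= `|h (t, x, y) - h (t', x, y)| +
   `|h (t', x, y) - h (t', x', y)| + `|h (t', x', y) - h (t', x', y')|.
  apply: le_trans (ler_distD (h (t', x', y)) _ _) _.
  by rewrite lerD2r; exact: ler_distD.
have := normr_ge0 (t - t'); have := normr_ge0 (x - x'); have := normr_ge0 (y - y').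
nra.
Qed.

Lemma schwartz_bounded (f : V -> R[i]) (w : seq 'I_3) m : schwartz f ->
  exists2 M : R, 0 <= M & forall z, weight z ^+ m * normc (cpartials w f z) <= M.
Proof.
move=> [_ _ /(_ w m)[M MP]]; exists M => //; apply: le_trans (MP 0).
by rewrite mulr_ge0 ?normc_ge0// exprn_ge0// /weight !addr_ge0// sqr_ge0.
Qed.

(** The Schwartz seminorms with one derivative and weight exponent 0 bound all first partials, so
    the Lipschitz criterion applies to the real and imaginary parts. *)
Lemma schwartz_cmeasurable (f : V -> R[i]) : schwartz f ->
  cmeasurable setT (f : mR * mR * mR -> R[i]).
Proof.
move=> sf; have [_ df _] := sf.
have B (k : 'I_3) : exists M : R, forall z, normc (cpartials [:: k] f z) <= M.
  by have [M _ MP] := schwartz_bounded [:: k] 0 sf; exists M => z; have := MP z; rewrite expr0 mul1r.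
pose M k := sval (cid (B k)).
have MP k z : normc (cpartials [:: k] f z) <= M 0 + M 1 + M 2.
  have M0 j : 0 <= M j by rewrite (le_trans (normc_ge0 _) (svalP (cid (B j)) 0)).
  rewrite (le_trans (svalP (cid (B k)) z))// -/(M k).
  move: (M0 0) (M0 1) (M0 2); case: k => -[|[|[|//]]] i.
  - rewrite (_ : Ordinal i = 0); last exact/val_inj.
    by generalize (M 0) (M 1) (M 2) => *; lra.
  - rewrite (_ : Ordinal i = 1); last exact/val_inj.
    by generalize (M 0) (M 1) (M 2) => *; lra.
  - rewrite (_ : Ordinal i = 2); last exact/val_inj.
    by generalize (M 0) (M 1) (M 2) => *; lra.
split.
- apply: (@bounded_partials_measurable _ (M 0 + M 1 + M 2)) => k z.
  + exact: (df [::] k z).1.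
  + by apply: le_trans (MP k z); exact: (Re_le_normc (cpartials [:: k] f z)).
- apply: (@bounded_partials_measurable _ (M 0 + M 1 + M 2)) => k z.
  + exact: (df [::] k z).2.
  + by apply: le_trans (MP k z); exact: (Im_le_normc (cpartials [:: k] f z)).
Qed.

End SchwartzMeasurable.

(** * Polynomials times a Gaussian *)

Section RealLine.
Variable R : realType.
Local Notation mu := (@lebesgue_measure R).

Lemma integral_oneDsqrV : (\int[mu]_x ((1 + x ^+ 2)^-1)%:E = pi%:E)%E.
Proof.
rewrite (@ge0_symfun_integralT R (fun x : R => (1 + x ^+ 2)^-1)).
- rewrite (_ : [set x | _] = `[0, +oo[%classic); last first.
    by apply/seteqP; split => x/=; rewrite in_itv/= andbT.
  by rewrite integral0y_oneDsqr -EFinM mulrCA divff// mulr1.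
- by move=> x; rewrite invr_ge0 addr_ge0// sqr_ge0.
- exact: continuous_oneDsqrV.
- by move=> x; rewrite /= sqrrN.
Qed.

Lemma measurable_oneDsqrV : measurable_fun setT (fun x : R => (1 + x ^+ 2)^-1).
Proof. apply: continuous_measurable_fun; exact: continuous_oneDsqrV. Qed.

Lemma integrable_oneDsqrV : mu.-integrable setT (fun x => ((1 + x ^+ 2)^-1)%:E).
Proof.
apply/integrableP; split; first by apply/measurable_EFinP; exact: measurable_oneDsqrV.
under eq_integral => x _.
  rewrite gee0_abs; last by rewrite lee_fin invr_ge0 addr_ge0// sqr_ge0.
  over.
by rewrite integral_oneDsqrV ltry.
Qed.

Lemma ge0_integral_shift (G : R -> R) (c : R) : continuous G ->
  (forall x, 0 <= G x) -> (\int[mu]_x (G (x + c))%:E = \int[mu]_x (G x)%:E)%E.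
Proof.
move=> cG G0.
pose F (x : R) := x + c.
have dF (x : R) : is_derive x 1 F 1.
  by rewrite -[X in is_derive _ _ _ X]addr0; apply: is_deriveD.
have F'E : F^`()%classic = cst 1.
  by apply/funext => x; rewrite derive1E; exact: derive_val.
rewrite [RHS](@increasing_ge0_integration_by_substitutionT R F G)//.
- by apply: eq_integral => x _; rewrite F'E /= mulr1.
- by move=> x y xy; rewrite /F ltrD2r.
- by rewrite F'E => ?; exact: cvg_cst.
- by rewrite F'E; exact: is_cvg_cst.
- by rewrite F'E; exact: is_cvg_cst.
- exact: cvg_addrr_Ny.
- exact: cvg_addrr.
Qed.

Lemma cvg_oneDsqrV : (1 + n%:R ^+ 2 : R)^-1 @[n --> \oo] --> (0 : R).
Proof.
apply: (@squeeze_cvgr _ _ _ _ (cst 0) (fun n : nat => n.+1%:R^-1)).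
- near=> n; rewrite invr_ge0 addr_ge0 ?sqr_ge0//= lef_pV2 ?posrE ?ltr0n//.
  rewrite -natr1 addrC lerD2l -natrX ler_nat.
  by case: (n) => // m; rewrite leq_pmulr.
- exact: cvg_cst.
- exact: cvg_harmonic.
Unshelve. all: by end_near. Qed.

(** Over [[-n, n]] the integral is [H n - H (- n)], which tends to 0 by the decay of [H]; dominated
    convergence identifies the limit with the integral over the line. *)
Lemma Rintegral_derivative_eq0 (H H' : R -> R) (K : R) :
  (forall x : R, is_derive x 1 H (H' x)) -> continuous H' ->
  mu.-integrable setT (fun x => (H' x)%:E) ->
  (forall x, `|H x| <= K / (1 + x ^+ 2)) ->
  (\int[mu]_x H' x = 0)%R.
Proof.
move=> dH cH' iH' HK.
pose I (n : nat) : set R := `[- n%:R, n%:R]%classic.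
pose f_ (n : nat) x := ((H' \_ (I n)) x)%:E.
have mH' : measurable_fun setT (fun x => (H' x)%:E).
  by apply/measurable_EFinP; exact: continuous_measurable_fun.
have mf n : measurable_fun setT (f_ n).
  apply/measurable_EFinP; apply/(measurable_restrictT _ _).1.
    exact: measurable_itv.
  by apply: measurable_funTS; exact: continuous_measurable_fun.
have cvf x : f_ ^~ x @ \oo --> (H' x)%:E.
  apply: cvg_near_cst; exists (Num.truncn `|x|).+1 => // n /= xn.
  rewrite /f_ patchE ifT// inE /I /= in_itv /= -ler_norml ltW//.
  by rewrite (lt_le_trans (truncnS_gt _))// ler_nat.
have dom n x : (`|f_ n x| <= `|(H' x)%:E|)%E.
  rewrite /f_ /= lee_fin patchE; case: ifP => // _.
  (* Outside the interval the restriction takes the default value of [R], which is 0. *)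
  by rewrite /point /= normr0.
have iabs := integrable_abse iH'.
have [||_ _ lim1] := @dominated_convergence _ _ _ mu setT measurableT f_ _ _
    mf mH' _ iabs _.
- by apply: aeW => x _; exact: cvf.
- by apply: aeW => x n _; exact: dom.
have lim2 : (\int[mu]_x f_ n x)%E @[n --> \oo] --> 0%E.
  (* The index is shifted because the fundamental theorem needs a nondegenerate interval, and
     [n = 0] gives a single point. *)
  have Hn n : (\int[mu]_x f_ n.+1 x = (H n.+1%:R - H (- n.+1%:R))%:E)%E.
    transitivity (\int[mu]_x ((EFin \o H') \_ (I n.+1)) x)%E.
      by apply: eq_integral => x _; rewrite restrict_EFin.
    rewrite -integral_mkcond (@continuous_FTC2 _ _ H)//.
    - by rewrite (@lt_trans _ _ 0)// ?oppr_lt0 ltr0n.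
    - exact: continuous_subspaceT.
    - have cH x : {for x, continuous H}.
        exact/differentiable_continuous/derivable1_diffP.
      split.
      + by move=> x _; have [] := dH x.
      + by apply: cvg_at_right_filter; exact: cH.
      + by apply: cvg_at_left_filter; exact: cH.
    - by move=> x _; rewrite derive1E; exact: derive_val.
  rewrite -(cvg_shiftS (fun n => \int[mu]_x f_ n x)%E).
  under eq_fun do rewrite Hn.
  apply: cvg_EFin; first by near=> n.
  apply: norm_cvg0.
  apply: (@squeeze_cvgr _ _ _ _ (cst 0) (fun n : nat => 2 * K * (1 + n.+1%:R ^+ 2)^-1)).
  - near=> n; rewrite /= normr_ge0 /= (le_trans (ler_normB _ _))//.
    rewrite -mulrA mulr2n mulrDl !mul1r lerD//.
    by have := HK (- n.+1%:R); rewrite sqrrN.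
  - exact: cvg_cst.
  - rewrite -(mulr0 (2 * K)); apply: cvgMr.
    by have := cvg_oneDsqrV; rewrite -(cvg_shiftS (fun n : nat => (1 + n%:R ^+ 2 : R)^-1)).
have L : (\int[mu]_x (H' x)%:E = 0)%E.
  exact: cvg_unique lim1 lim2.
by rewrite /Rintegral L.
Unshelve. all: by end_near. Qed.

End RealLine.

Section PolyGauss.
Variable R : realType.
Local Notation mu := (@lebesgue_measure R).
Implicit Types p q : {poly R}.

Definition pgauss p (x : R) : R := p.[x] * gauss_fun x.

(** Differentiating [exp (- x^2)] brings down [- 2 x]; this is the polynomial factor of the
    derivative of [pgauss p]. *)
Definition dpgauss p : {poly R} := p^`() - ('X * p) *+ 2.

Lemma is_derive_pgauss p (x : R) : is_derive x 1 (pgauss p) (pgauss (dpgauss p) x).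
Proof.
have dg : is_derive x 1 (@gauss_fun R) (- (2 * x) * gauss_fun x).
  have dsq : is_derive x 1 (fun y : R => - y ^+ 2) (- (2 * x)).
    by apply: is_deriveN; apply: is_derive_eq; rewrite /GRing.scale /=; ring.
  by have := is_derive1_comp (is_derive_expR _) dsq; rewrite mulrC.
apply: is_derive_eq.
rewrite /pgauss /dpgauss hornerD hornerN hornerMn hornerM hornerX /GRing.scale /=.
by ring.
Qed.

Lemma continuous_pgauss p : continuous (pgauss p).
Proof.
move=> x; have := is_derive_pgauss p x => -[dp _].
exact/differentiable_continuous/derivable1_diffP.
Qed.

Lemma measurable_pgauss p : measurable_fun setT (pgauss p).
Proof. by apply: continuous_measurable_fun; exact: continuous_pgauss. Qed.

Lemma pgaussB p q x : pgauss (p - q) x = pgauss p x - pgauss q x.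
Proof. by rewrite /pgauss hornerD hornerN mulrBl. Qed.

(** For [n > 0], [1 + x^2 <= n (1 + x^2 / n) <= n exp (x^2 / n)]; raise this to the power [n]. *)
Lemma oneDsqrX_gauss_le (n : nat) (x : R) :
  (1 + x ^+ 2) ^+ n * gauss_fun x <= n%:R ^+ n.
Proof.
case: n => [|n]; first by rewrite !expr0 mul1r gauss_fun_le1.
have n0 : 0 < n.+1%:R :> R by rewrite ltr0n.
have h : (1 + x ^+ 2) ^+ n.+1 <= n.+1%:R ^+ n.+1 * expR (x ^+ 2).
  have -> : expR (x ^+ 2) = expR (x ^+ 2 / n.+1%:R) ^+ n.+1.
    by rewrite -expRM_natr divfK ?gt_eqF.
  rewrite -exprMn lerXn2r ?nnegrE ?mulr_ge0 ?expR_ge0 ?addr_ge0 ?sqr_ge0//.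
  rewrite (le_trans _ (ler_wpM2l (ltW n0) (expR_ge1Dx _)))//.
  by rewrite mulrDr mulr1 mulrCA divff ?gt_eqF// mulr1 lerD2r ler1n.
by rewrite /gauss_fun expRN ler_pdivrMr ?expR_gt0.
Qed.

(** Horner induction: each multiplication by [X] costs one factor [1 + x^2], which dominates
    [|x|]. *)
Lemma horner_le_oneDsqrX p : exists2 K : R, 0 <= K &
  forall x, `|p.[x]| <= K * (1 + x ^+ 2) ^+ size p.
Proof.
have o1 (x : R) : 1 <= 1 + x ^+ 2 by rewrite lerDl sqr_ge0.
elim/poly_ind: p => [|p c [K K0 KP]].
  by exists 0 => // x; rewrite horner0 normr0 mul0r.
have [->|p0] := eqVneq p 0.
  exists `|c| => // x; rewrite mul0r add0r hornerC.
  by rewrite ler_peMr// exprn_ege1.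
exists (K + `|c|) => [|x]; first by rewrite addr_ge0.
rewrite size_MXaddC (negPf p0) /= hornerMXaddC.
rewrite (le_trans (ler_normD _ _))// mulrDl lerD//; last first.
  by rewrite ler_peMr// exprn_ege1.
rewrite normrM exprSr mulrA ler_pM//.
have [x1|x1] := lerP `|x| 1; first exact: le_trans x1 (o1 x).
rewrite -[x ^+ 2]real_normK ?num_real// (@le_trans _ _ (`|x| ^+ 2))//.
  by rewrite expr2 ler_peMl// ltW.
by rewrite lerDr.
Qed.

Lemma pgauss_bounded p m : exists2 K : R, 0 <= K &
  forall x, (1 + x ^+ 2) ^+ m * `|pgauss p x| <= K.
Proof.
have [K K0 KP] := horner_le_oneDsqrX p.
exists (K * (m + size p)%:R ^+ (m + size p)) => [|x].
  by rewrite mulr_ge0 ?exprn_ge0.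
rewrite /pgauss normrM (ger0_norm (gauss_fun_ge0 x)).
have o0 : 0 <= (1 + x ^+ 2) ^+ m by rewrite exprn_ge0// addr_ge0// sqr_ge0.
have := ler_wpM2l K0 (oneDsqrX_gauss_le (m + size p) x); apply: le_trans.
rewrite exprD -mulrA [leRHS]mulrCA ler_wpM2l//.
by rewrite mulrA ler_wpM2r ?gauss_fun_ge0.
Qed.

Lemma pgauss_le_oneDsqrV p : exists2 K : R, 0 <= K &
  forall x, `|pgauss p x| <= K * (1 + x ^+ 2)^-1.
Proof.
have [K K0 KP] := pgauss_bounded p 1; exists K => // x.
by rewrite ler_pdivlMr ?ltr_pwDl ?sqr_ge0// mulrC -{1}[1 + _]expr1.
Qed.

Lemma integrable_pgauss p : mu.-integrable setT (fun x => (pgauss p x)%:E).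
Proof.
have [K K0 KP] := pgauss_le_oneDsqrV p.
have := integrableZl measurableT K (@integrable_oneDsqrV R).
apply: le_integrable => //.
- by apply/measurable_EFinP; exact: measurable_pgauss.
- by move=> x _ /=; rewrite lee_fin (le_trans (KP x))// ler_norm.
Qed.

Lemma integrableM_bounded (f h : R -> R) : measurable_fun setT f ->
  measurable_fun setT h -> (forall x, `|h x| <= 1) ->
  mu.-integrable setT (fun x => (f x)%:E) ->
  mu.-integrable setT (fun x => (f x * h x)%:E).
Proof.
move=> mf mh h1; apply: le_integrable => //.
- by apply/measurable_EFinP; exact: measurable_funM.
- by move=> x _ /=; rewrite lee_fin normrM ler_piMr.
Qed.

Lemma cos_le1_norm (x : R) : `|cos x| <= 1.
Proof. by rewrite ler_norml cos_le1 cos_geN1. Qed.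

Lemma sin_le1_norm (x : R) : `|sin x| <= 1.
Proof. by rewrite ler_norml sin_le1 sin_geN1. Qed.

Lemma is_derive_affine (f : R -> R) (a c x d : R) :
  is_derive (a * x + c) 1 f d -> is_derive x 1 (fun y => f (a * y + c)) (a * d).
Proof.
move=> df.
have dg : is_derive x 1 (fun y : R => a * y + c) a.
  by apply: is_derive_eq; rewrite /GRing.scale /= mulr1 addr0.
by have := @is_derive1_comp R f (fun y => a * y + c) x d a df dg; rewrite mulrC.
Qed.

(* With [h = pgauss p], the derivative of [- h' cos - xi h sin] (the
   trigonometric functions being taken at [xi x + c]) is
   [- h'' cos - xi^2 h cos]: this is two integrations by parts at once. *)
Lemma oneDsqr_Rintegral_pgauss_cos p (xi c : R) :
  ((1 + xi ^+ 2) * \int[mu]_x (pgauss p x * cos (xi * x + c)) =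
   \int[mu]_x (pgauss (p - dpgauss (dpgauss p)) x * cos (xi * x + c)))%R.
Proof.
have mcos : measurable_fun setT (fun x : R => cos (xi * x + c)).
  apply: (measurableT_comp (f := @cos R)).
    by apply: continuous_measurable_fun; exact: continuous_cos.
  by apply: measurable_funD => //; exact: measurable_funM.
have ig q : mu.-integrable setT (EFin \o (fun x => pgauss q x * cos (xi * x + c))).
  apply: integrableM_bounded => //; first exact: measurable_pgauss.
  - by move=> x; exact: cos_le1_norm.
  - exact: integrable_pgauss.
pose H x := - (pgauss (dpgauss p) x * cos (xi * x + c))
  - xi * (pgauss p x * sin (xi * x + c)).
(* The derivative is written as the difference of the two integrands to be compared, so that its
   vanishing integral is the claimed identity. *)
pose H' x := pgauss (p - dpgauss (dpgauss p)) x * cos (xi * x + c)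
  - (1 + xi ^+ 2) * (pgauss p x * cos (xi * x + c)).
have iH' : mu.-integrable setT (EFin \o H').
  have := integrableB measurableT (ig (p - dpgauss (dpgauss p)))
    (integrableZl measurableT (1 + xi ^+ 2) (ig p)).
  by apply: eq_integrable.
have dH (x : R) : is_derive x 1 H (H' x).
  have dc := is_derive_affine (is_derive_cos (xi * x + c)).
  have ds := is_derive_affine (is_derive_sin (xi * x + c)).
  have d0 := is_derive_pgauss p x; have d1 := is_derive_pgauss (dpgauss p) x.
  rewrite /H; apply: is_derive_eq.
  by rewrite /H' pgaussB /GRing.scale /=; ring.
have cH' : continuous H'.
  have cc : continuous (fun x : R => cos (xi * x + c)).
    move=> x; apply: differentiable_continuous; apply/derivable1_diffP.
    by have [] := is_derive_affine (is_derive_cos (xi * x + c)).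
  move=> x; apply: cvgB; [|apply: cvgMr]; (apply: cvgM; [exact: continuous_pgauss|exact: cc]).
have [K1 K10 K1P] := pgauss_le_oneDsqrV p.
have [K2 K20 K2P] := pgauss_le_oneDsqrV (dpgauss p).
have := @Rintegral_derivative_eq0 R H H' (K2 + `|xi| * K1) dH cH' iH'.
rewrite /H' RintegralB// ?RintegralZl//; last first.
  by have := integrableZl measurableT (1 + xi ^+ 2) (ig p); apply: eq_integrable.
move=> E; apply/esym/eqP; rewrite -subr_eq0; apply/eqP/E => x.
rewrite /H (le_trans (ler_normB _ _))// mulrDl lerD//.
- by rewrite normrN normrM (le_trans _ (K2P x))// ler_piMr// cos_le1_norm.
- rewrite normrM -[leRHS]mulrA ler_wpM2l// normrM (le_trans _ (K1P x))//.
  by rewrite ler_piMr// sin_le1_norm.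
Qed.

(** Each factor [1 + xi^2] is traded for replacing [h] by [h - h''], again a polynomial times a
    Gaussian. The bound is uniform in the phase [c], so sine integrals are covered as well. *)
Lemma Rintegral_pgauss_cos_bounded p m : exists2 K : R, 0 <= K & forall xi c,
  (1 + xi ^+ 2) ^+ m * `|(\int[mu]_x (pgauss p x * cos (xi * x + c)))%R| <= K.
Proof.
elim: m p => [p|m IH p].
  exists (\int[mu]_x `|pgauss p x|)%R => [|xi c].
    by apply: Rintegral_ge0.
  have mcos : measurable_fun setT (fun x : R => cos (xi * x + c)).
    apply: (measurableT_comp (f := @cos R)).
      by apply: continuous_measurable_fun; exact: continuous_cos.
    by apply: measurable_funD => //; exact: measurable_funM.
  have ig : mu.-integrable setT (EFin \o (fun x => pgauss p x * cos (xi * x + c))).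
    apply: integrableM_bounded => //; first exact: measurable_pgauss.
    - by move=> x; exact: cos_le1_norm.
    - exact: integrable_pgauss.
  rewrite expr0 mul1r (le_trans (le_normr_Rintegral _ _))//.
  apply: le_Rintegral => //.
  - by have := integrable_abse ig; apply: eq_integrable.
  - by have := integrable_abse (integrable_pgauss p); apply: eq_integrable.
  - by move=> x _; rewrite normrM ler_piMr// cos_le1_norm.
have [K K0 KP] := IH (p - dpgauss (dpgauss p)); exists K => // xi c.
have o0 : 0 <= 1 + xi ^+ 2 by rewrite addr_ge0// sqr_ge0.
rewrite exprSr -mulrA -{2}(ger0_norm o0) -normrM oneDsqr_Rintegral_pgauss_cos.
exact: KP.
Qed.

End PolyGauss.

(** * Gaussian waves are Schwartz functions *)

Section SchwartzWave.
Variables (R : realType) (a : R) (n : nat).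
Local Notation V := (R * R * R)%type.

(** The free phase [c] puts cosine and sine into one family: a derivative in [y] multiplies by [n]
    and replaces [c] by [c + pi / 2]. *)
Definition wave (p q : {poly R}) (c : R) (z : V) : R :=
  pgauss p z.1.1 * pgauss q (z.1.2 + a * z.1.1) * cos (n%:R * z.2 + c).

(** The linear span of the waves. It is stable under differentiation along the axes, so one decay
    estimate covers partial derivatives of every order. *)
Inductive waves : (V -> R) -> Prop :=
| waves_wave p q c : waves (wave p q c)
| wavesZ k f : waves f -> waves (fun z => k * f z)
| wavesD f g : waves f -> waves g -> waves (fun z => f z + g z).

Lemma wave_derive p q c (k : 'I_3) : exists2 g, waves g &
  forall z, is_derive z (axis R k) (wave p q c) (g z).
Proof.
pose k0 : R := (k == 0%N :> nat)%:R; pose k1 : R := (k == 1%N :> nat)%:R.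
pose k2 : R := (k == 2%N :> nat)%:R.
(* The 0/1 numbers [k0], [k1], [k2] treat the three axes at once; the coefficient [k1 + a * k0]
   appears because [t] also enters the second Gaussian through the shear. *)
exists (fun z => k0 * wave (dpgauss p) q c z + (k1 + a * k0) * wave p (dpgauss q) c z +
  n%:R * k2 * wave p q (c + pi / 2) z).
  by apply: wavesD; [apply: wavesD|]; apply: wavesZ; exact: waves_wave.
(* The point is viewed as the one at parameter 0 on the line through it along the axis. *)
move=> [[t x] y]; rewrite -[X in is_derive X](add0r (t, x, y)) -(scale0r (axis R k)).
apply/is_derive_line.
under eq_fun do rewrite axisE -/k0 -/k1 -/k2.
rewrite [X in is_derive _ _ X _](_ : _ = fun r => pgauss p (k0 * r + t) *
  pgauss q ((k1 + a * k0) * r + (x + a * t)) *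
  cos ((n%:R * k2) * r + (n%:R * y + c))); last first.
  apply/funext => r; rewrite /wave /=; congr (pgauss p _ * pgauss q _ * cos _); ring.
have d0 := is_derive_affine (is_derive_pgauss p (k0 * 0 + t)).
have d1 := is_derive_affine (is_derive_pgauss q ((k1 + a * k0) * 0 + (x + a * t))).
have d2 := is_derive_affine (is_derive_cos ((n%:R * k2) * 0 + (n%:R * y + c))).
apply: is_derive_eq.
rewrite /wave /= (addrA (n%:R * y) c) cosDpihalf /GRing.scale /= !mulr0 !add0r.
by ring.
Qed.

Lemma waves_derive f (k : 'I_3) : waves f -> exists2 g, waves g &
  forall z, is_derive z (axis R k) f (g z).
Proof.
elim=> [p q c|l {}f _ [g Wg dg]|{}f f' _ [g Wg dg] _ [g' Wg' dg']].
- exact: wave_derive.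
- by exists (fun z => l * g z) => [|z]; [exact: wavesZ|exact: is_deriveZ].
- by exists (fun z => g z + g' z) => [|z]; [exact: wavesD|exact: is_deriveD].
Qed.

Lemma waves_partials f w : waves f -> waves (partials w f).
Proof.
move=> Wf; elim: w => //= k w IH.
have [g Wg dg] := waves_derive k IH.
rewrite (_ : 'D_(axis R k) (partials w f) = g)//.
by apply/funext => z; have [_ ->] := dg z.
Qed.

(** As [x = (x + a t) - a t], [x^2 <= 2 (x + a t)^2 + 2 a^2 t^2]: undoing the shear costs a
    constant, and the weight splits between the two Gaussian arguments. *)
Lemma weight_shear_le (t x y : R) :
  weight (t, x, y) <= (2 + 2 * a ^+ 2) * ((1 + t ^+ 2) * (1 + (x + a * t) ^+ 2)).
Proof.
rewrite /weight /=.
have := sqr_ge0 a; have := sqr_ge0 t; have := sqr_ge0 (x + a * t).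
have := sqr_ge0 (x + a * t + a * t).
have H1 := mulr_ge0 (sqr_ge0 t) (sqr_ge0 (x + a * t)).
have H2 := mulr_ge0 (sqr_ge0 a) (sqr_ge0 (x + a * t)).
have H3 := mulr_ge0 (sqr_ge0 a) H1.
nra.
Qed.

Lemma waves_decay f m : waves f ->
  exists M : R, forall z, weight z ^+ m * `|f z| <= M.
Proof.
elim=> [p q c|l {}f _ [M MP]|f1 f2 _ [M1 MP1] _ [M2 MP2]].
- have [K K0 KP] := pgauss_bounded p m.
  have [L L0 LP] := pgauss_bounded q m.
  exists ((2 + 2 * a ^+ 2) ^+ m * (K * L)) => -[[t x] y].
  have o0 (s : R) : 0 <= 1 + s ^+ 2 by rewrite addr_ge0// sqr_ge0.
  have c0 : 0 <= 2 + 2 * a ^+ 2 by rewrite addr_ge0// mulr_ge0// sqr_ge0.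
  have w0 : 0 <= weight (t, x, y) by rewrite /weight !addr_ge0// sqr_ge0.
  have W : weight (t, x, y) ^+ m <= (2 + 2 * a ^+ 2) ^+ m *
      ((1 + t ^+ 2) ^+ m * (1 + (x + a * t) ^+ 2) ^+ m).
    by rewrite -!exprMn lerXn2r ?nnegrE ?mulr_ge0// weight_shear_le.
  rewrite /wave normrM normrM /=.
  rewrite (le_trans (ler_wpM2r _ W))// ?mulr_ge0//.
  rewrite -[leLHS]mulrA ler_wpM2l ?exprn_ge0//.
  rewrite (@le_trans _ _ (((1 + t ^+ 2) ^+ m * `|pgauss p t|) *
    ((1 + (x + a * t) ^+ 2) ^+ m * `|pgauss q (x + a * t)|)))//; last first.
    by rewrite ler_pM// ?mulr_ge0// ?exprn_ge0.
  rewrite [leRHS]mulrACA ler_wpM2l ?mulr_ge0 ?exprn_ge0//.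
  by rewrite ler_piMr ?mulr_ge0// cos_le1_norm.
- exists (`|l| * M) => z; rewrite normrM mulrCA ler_wpM2l//.
- exists (M1 + M2) => z; rewrite (le_trans _ (lerD (MP1 z) (MP2 z)))//.
  by rewrite -mulrDr ler_wpM2l ?ler_normD// exprn_ge0// /weight !addr_ge0// sqr_ge0.
Qed.

Lemma wave_periodic p q c t x y :
  wave p q c (t, x, y + 2 * pi) = wave p q c (t, x, y).
Proof.
rewrite /wave /=; congr (_ * _).
rewrite (_ : n%:R * (y + 2 * pi) + c = (n%:R * y + c) + (pi *+ 2) *+ n); last first.
  by rewrite -[(pi *+ 2) *+ n]mulr_natl; ring.
by rewrite (periodicn (@cosD2pi R)).
Qed.

(** The phase [pi / 2] makes the imaginary part carry [- sin (n y)], so for [a = n^2] this is the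
    conjugate of u_n. *)
Definition test_wave : V -> R[i] := fun z =>
  (wave 1 1 0 z +i* wave 1 1 (pi / 2) z)%C.

Lemma schwartz_test_wave : schwartz test_wave.
Proof.
have W0 : waves (fun z => complex.Re (test_wave z)) by exact: waves_wave.
have W1 : waves (fun z => complex.Im (test_wave z)) by exact: waves_wave.
split.
- by move=> t x y; rewrite /test_wave !wave_periodic.
- move=> w k z; split.
  + by have [g _ /(_ z)[]] := waves_derive k (waves_partials w W0).
  + by have [g _ /(_ z)[]] := waves_derive k (waves_partials w W1).
- move=> w m.
  have [M0 M0P] := waves_decay m (waves_partials w W0).
  have [M1 M1P] := waves_decay m (waves_partials w W1).
  exists (M0 + M1) => z.
  rewrite (le_trans _ (lerD (M0P z) (M1P z)))// -mulrDr ler_wpM2l//.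
    by rewrite exprn_ge0// /weight !addr_ge0// sqr_ge0.
  exact: normc_le_ReIm.
Qed.

End SchwartzWave.

(** * One-dimensional transforms *)

Section GaussTransform.
Variable R : realType.
Local Notation mR := (measurableTypeR R).
Local Notation mu := (@lebesgue_measure R).

Lemma gauss_pgauss (x : R) : gauss_fun x = pgauss 1 x.
Proof. by rewrite /pgauss hornerC mul1r. Qed.

Definition gauss_hat (xi : R) : R[i] :=
  cintegral mu setT (fun x => (gauss_fun x)%:C%C * cis (- (xi * x))).

Lemma cmeasurable_gauss_cis (xi : R) :
  cmeasurable setT (fun x : mR => (gauss_fun x)%:C%C * cis (- (xi * x))).
Proof.
apply: cmeasurableM.
- by apply: cmeasurable_real; exact: measurable_gauss_fun.
- by apply: cmeasurable_cis; apply: measurable_funN; exact: measurable_funM.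
Qed.

Lemma normc_gauss_cis (xi x : R) :
  normc ((gauss_fun x)%:C%C * cis (- (xi * x))) = gauss_fun x.
Proof. by rewrite normcM normc_real normc_cis mulr1 ger0_norm ?gauss_fun_ge0. Qed.

(** The imaginary part is a cosine integral with phase [- pi / 2], so both parts obey the same
    estimate. Squaring is harmless because the weight is at least 1. *)
Lemma gauss_hat_decay m : exists2 K : R, 0 <= K & forall xi,
  (1 + xi ^+ 2) ^+ m * normc (gauss_hat xi) ^+ 2 <= K.
Proof.
have [K K0 KP] := Rintegral_pgauss_cos_bounded (1 : {poly R}) m.
exists ((2 * K) ^+ 2) => [|xi]; first exact: sqr_ge0.
have o1 : 1 <= 1 + xi ^+ 2 by rewrite lerDl sqr_ge0.
have o0 : 0 <= (1 + xi ^+ 2) ^+ m by rewrite exprn_ge0// (le_trans ler01).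
have B : (1 + xi ^+ 2) ^+ m * normc (gauss_hat xi) <= 2 * K.
  rewrite (le_trans (ler_wpM2l o0 (normc_le_ReIm _)))// mulrDr mulr2n mulrDl !mul1r.
  rewrite /gauss_hat /cintegral /= lerD//.
  - have := KP (- xi) 0; rewrite sqrrN; congr (_ * `|_| <= _).
    apply: eq_Rintegral => x _.
    by rewrite -gauss_pgauss mul0r subr0 addr0 mulNr.
  - have := KP (- xi) (- (pi / 2)); rewrite sqrrN; congr (_ * `|_| <= _).
    apply: eq_Rintegral => x _.
    by rewrite -gauss_pgauss mul0r addr0 cosBpihalf mulNr.
apply: le_trans (_ : ((1 + xi ^+ 2) ^+ m * normc (gauss_hat xi)) ^+ 2 <= _).
  rewrite exprMn ler_wpM2r ?sqr_ge0// expr2 ler_peMl//.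
  by rewrite exprn_ege1.
by rewrite lerXn2r ?nnegrE ?mulr_ge0 ?normc_ge0.
Qed.

(* Dividing by [1 + x^2] makes the kernel integrable in both variables, so that
   Fubini's theorem gives the measurability. *)
Lemma measurable_Rintegral_param (k : mR * mR -> R) (h : mR -> R) :
  measurable_fun setT k -> mu.-integrable setT (fun y => (h y)%:E) ->
  (forall x y, `|k (x, y)| <= h y) ->
  measurable_fun setT (fun x : mR => \int[mu]_y k (x, y))%R.
Proof.
move=> mk ih kh.
pose k' (z : mR * mR) : R := (1 + z.1 ^+ 2)^-1 * k z.
have o0 (x : R) : 0 < 1 + x ^+ 2 by rewrite ltr_pwDl// sqr_ge0.
have mk' : measurable_fun setT k'.
  by apply: measurable_funM => //; exact: measurableT_comp (@measurable_oneDsqrV R) measurable_fst.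
have k'h x y : `|k' (x, y)| <= (1 + x ^+ 2)^-1 * h y.
  have i0 : 0 <= (1 + x ^+ 2)^-1 by rewrite invr_ge0 ltW.
  by rewrite /k' normrM /= (ger0_norm i0) ler_wpM2l.
have ik x : mu.-integrable setT (EFin \o (fun y => k (x, y))).
  apply: le_integrable ih => //.
  - by apply/measurable_EFinP; exact: measurable_fun_pair2.
  - by move=> y _ /=; rewrite lee_fin (le_trans (kh _ _))// ler_norm.
have mI := measurable_fubini_F (integrable_dominated_tensor mk' (@integrable_oneDsqrV R) ih k'h).
rewrite (_ : (fun x : mR => _) =
   fun x => (1 + x ^+ 2) * fine (fubini_F mu (fun z => (k' z)%:E) x)).
  apply: measurable_funM.
  - by apply: measurable_funD => //; exact: measurable_funX.
  - by apply: measurableT_comp mI; exact: fine_measurable.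
apply/funext => x; rewrite /fubini_F.
have := RintegralZl (1 + x ^+ 2)^-1 measurableT (ik x).
by rewrite /Rintegral /= => ->; rewrite mulVKf// gt_eqF.
Qed.

Lemma cmeasurable_gauss_hat : cmeasurable setT (gauss_hat : mR -> R[i]).
Proof.
have m1 : measurable_fun setT (fun z : mR * mR => - (z.1 * z.2)).
  apply: measurable_funN; apply: measurable_funM.
  - exact: measurable_fst.
  - exact: measurable_snd.
have mg : cmeasurable setT
    (fun z : mR * mR => (gauss_fun z.2)%:C%C * cis (- (z.1 * z.2))).
  apply: cmeasurableM; last exact: cmeasurable_cis.
  apply: cmeasurable_real; exact: measurableT_comp measurable_gauss_fun measurable_snd.
split.
- apply: (measurable_Rintegral_param mg.1 integrableT_gauss) => x y.
  by rewrite (le_trans (Re_le_normc _))// normc_gauss_cis.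
- apply: (measurable_Rintegral_param mg.2 integrableT_gauss) => x y.
  by rewrite (le_trans (Im_le_normc _))// normc_gauss_cis.
Qed.

End GaussTransform.

(** * Orthogonality of characters on the circle *)

Section CircleIntegrals.
Variable R : realType.
Local Notation mu := (@lebesgue_measure R).
Local Notation I := (`[0, 2 * pi[%classic : set R).

Lemma twopi_gt0 : 0 < 2 * pi :> R.
Proof. by rewrite mulr_gt0// pi_gt0. Qed.

Lemma integrable_circle_indic : mu.-integrable setT (fun y => (\1_I y)%:E).
Proof. exact: integrable_indic_itv. Qed.

Lemma Rintegral_circle_indic : (\int[mu]_y (\1_I y : R) = 2 * pi)%R.
Proof.
rewrite /Rintegral integral_indic//= setIT lebesgue_measure_itv /= lte_fin twopi_gt0.
by rewrite oppr0 adde0.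
Qed.

Lemma Rintegral_circle_cos (m c : R) (f : R -> R) : m != 0 ->
  f (m * (2 * pi) + c) = f c ->
  (forall x : R, is_derive x 1 f (cos x)) ->
  (\int[mu]_y (\1_I y * cos (m * y + c)) = 0)%R.
Proof.
move=> m0 per df.
pose F (y : R) := m^-1 * f (m * y + c).
have dF (y : R) : is_derive y 1 F (cos (m * y + c)).
  have d := is_derive_affine (df (m * y + c)).
  by apply: is_derive_eq; rewrite /GRing.scale /= mulrA mulVf// mul1r.
have cc : continuous (fun y : R => cos (m * y + c)).
  move=> x; apply: differentiable_continuous; apply/derivable1_diffP.
  by have [] := is_derive_affine (is_derive_cos (m * x + c)).
have cF y : {for y, continuous F}.
  exact/differentiable_continuous/derivable1_diffP.
pose J : set R := `[0, 2 * pi]%classic.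
have E : (\int[mu]_(y in J) (cos (m * y + c))%:E = 0)%E.
  rewrite (@continuous_FTC2 _ _ F) ?twopi_gt0//.
  - by rewrite /F per mulr0 add0r -EFinB subrr.
  - exact: continuous_subspaceT.
  - split.
    + by move=> y _; have [] := dF y.
    + by apply: cvg_at_right_filter; exact: cF.
    + by apply: cvg_at_left_filter; exact: cF.
  - by move=> y _; rewrite derive1E; exact: derive_val.
transitivity (\int[mu]_(y in I) cos (m * y + c))%R.
  rewrite [RHS]Rintegral_mkcond; apply: eq_Rintegral => y _.
  by rewrite patchE indicE; case: ifP; rewrite ?mul1r ?mul0r.
(* The fundamental theorem was applied on the closed interval; the added endpoint is a null set. *)
rewrite Rintegral_itv_bndo_bndc; first by rewrite /Rintegral E.
apply: (@integrableS _ _ R mu J) => //.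
- exact: measurable_itv.
- by rewrite /J; apply: subset_itvl; rewrite bnd_simp.
- apply: continuous_compact_integrable; first exact: segment_compact.
  exact: continuous_subspaceT.
Qed.

(** The exponentials combine into one of integer frequency [n - q], whose integral over a full
    period vanishes unless the frequency is zero. The sine part is a cosine with phase
    [- pi / 2]. *)
Lemma cintegral_circle_mode (n : nat) (q : int) :
  cintegral mu setT (fun y => ((\1_I y)%:C%C * cis (n%:R * y)) * cis (- (y * q%:~R))) =
  (if q == n%:Z then 2 * pi else 0)%:C%C.
Proof.
transitivity (cintegral mu setT (fun y => (\1_I y)%:C%C * cis ((n%:R - q%:~R) * y))).
  apply: eq_cintegral.
  by move=> y _; rewrite -mulrA -cisD; congr (_ * cis _); ring.
rewrite /cintegral /=.
have [->|nq] := eqVneq q n%:Z.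
  apply/eqP; rewrite eq_complex /=; apply/andP; split; apply/eqP.
  - transitivity (\int[mu]_y (\1_I y : R))%R; last exact: Rintegral_circle_indic.
    apply: eq_Rintegral => y _.
    by rewrite -pmulrn subrr mul0r cos0 mul0r subr0 mulr1.
  - transitivity (\int[mu]_(y in setT) (0 : R))%R; last by rewrite /Rintegral integral0.
    apply: eq_Rintegral => y _.
    by rewrite -pmulrn subrr mul0r sin0 mul0r mulr0 addr0.
have m0 : (n%:R - q%:~R : R) != 0.
  by rewrite -[n%:R]/(n%:Z%:~R) -intrB intr_eq0 subr_eq0 eq_sym.
have P (c : R) : sin ((n%:R - q%:~R) * (2 * pi) + c) = sin c.
  have S (k : nat) x : sin (x + k%:R * (2 * pi)) = sin x :> R.
    rewrite mulr_natl [2 * pi]mulr_natl.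
    exact: periodicn (@sinD2pi R) k x.
  rewrite -[n%:R]/(n%:Z%:~R) -intrB addrC; case: (n%:Z - q) => k.
    by rewrite -[X in X * _]pmulrn S.
  (* For a negative frequency, periodicity is applied at the shifted point and adds the periods
     back. *)
  rewrite NegzE mulrNz mulNr -[X in _ - X * _]pmulrn.
  by rewrite -[LHS](S k.+1) subrK.
apply/eqP; rewrite eq_complex /=; apply/andP; split; apply/eqP.
- apply: etrans (@Rintegral_circle_cos _ 0 (@sin R) m0 (P 0) (@is_derive_sin R)).
  by apply: eq_Rintegral => y _; rewrite mul0r subr0 addr0.
- apply: etrans (@Rintegral_circle_cos _ (- (pi / 2)) (@sin R) m0 (P _) (@is_derive_sin R)).
  by apply: eq_Rintegral => y _; rewrite mul0r addr0 cosBpihalf.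
Qed.

End CircleIntegrals.

(** * The distribution of a sheared Gaussian wave *)

Section WaveDistribution.
Variable R : realType.
Local Notation mR := (measurableTypeR R).
Local Notation mu1 := (@lebesgue_measure R).
Local Notation V := (R * R * R)%type.
Local Notation I := (`[0, 2 * pi[%classic : set R).

(** This unfolds to the product measure, so the integrals in the definitions of the norms and
    pairings agree with it by conversion, while Fubini sees a sigma-finite measure. *)
Definition lebesgue2 : {sigma_finite_measure set (mR * mR)%type -> \bar R} :=
  sfprod mu1 mu1.
Definition lebesgue3 : {sigma_finite_measure set (mR * mR * mR)%type -> \bar R} :=
  sfprod lebesgue2 mu1.

Definition gauss2 (w : mR * mR) : R := gauss_fun w.1 * gauss_fun w.2.

Lemma gauss2_ge0 w : 0 <= gauss2 w.
Proof. by rewrite mulr_ge0 ?gauss_fun_ge0. Qed.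

Lemma gauss2_circle_ge0 w (y : R) : 0 <= gauss2 w * \1_I y.
Proof. by rewrite mulr_ge0 ?gauss2_ge0. Qed.

Lemma integrable_gauss2 : lebesgue2.-integrable setT (fun w => (gauss2 w)%:E).
Proof. exact: integrable_tensor (@integrableT_gauss R) (@integrableT_gauss R). Qed.

Lemma integrable_gauss2_circle :
  lebesgue3.-integrable setT (fun z => (gauss2 z.1 * \1_I z.2)%:E).
Proof. exact: integrable_tensor integrable_gauss2 (@integrable_circle_indic R). Qed.

Section Pairing.
Variables (a : R) (n : nat).

(** The substitution inverse to [x + a t]: the measure-preserving change of variables moves the
    shear from the wave onto the test function. *)
Definition shear (z : V) : V := (z.1.1, z.1.2 - a * z.1.1, z.2).

Lemma measurable_shear : measurable_fun setT (shear : mR * mR * mR -> mR * mR * mR).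
Proof.
have m11 : measurable_fun setT (fun z : mR * mR * mR => z.1.1).
  exact: measurableT_comp measurable_fst measurable_fst.
have m12 : measurable_fun setT (fun z : mR * mR * mR => z.1.2).
  exact: measurableT_comp measurable_snd measurable_fst.
apply: measurable_fun_pair; last exact: measurable_snd.
apply: measurable_fun_pair => //.
by apply: measurable_funB => //; exact: measurable_funM.
Qed.

(** The indicator of one period is part of the integrand, so integrals run over the whole product
    space and factor by the tensor form of Fubini. *)
Definition carrier (z : V) : R[i] :=
  (gauss2 z.1)%:C%C * ((\1_I z.2)%:C%C * cis (n%:R * z.2)).

Lemma measurable_gauss2 : measurable_fun setT gauss2.
Proof.
apply: measurable_funM.
- exact: measurableT_comp measurable_gauss_fun measurable_fst.
- exact: measurableT_comp measurable_gauss_fun measurable_snd.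
Qed.

Lemma cmeasurable_circle_cis :
  cmeasurable setT (fun y : mR => (\1_I y)%:C%C * cis (n%:R * y)).
Proof.
apply: cmeasurableM.
- by apply: cmeasurable_real; exact: measurable_indic.
- by apply: cmeasurable_cis; exact: measurable_funM.
Qed.

Lemma cmeasurable_carrier : cmeasurable setT (carrier : mR * mR * mR -> R[i]).
Proof.
apply: cmeasurableM.
- apply: (cmeasurable_comp (f := fun w => (gauss2 w)%:C%C)) => //.
  by apply: cmeasurable_real; exact: measurable_gauss2.
- exact: cmeasurable_comp cmeasurable_circle_cis measurable_snd.
Qed.

Lemma normc_circle_cis (y t : R) : normc ((\1_I y)%:C%C * cis t) = \1_I y.
Proof. by rewrite normcM normc_real normc_cis mulr1 ger0_norm. Qed.

Lemma normc_carrier z : normc (carrier z) = gauss2 z.1 * \1_I z.2.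
Proof.
by rewrite normcM normc_circle_cis normc_real ger0_norm ?gauss2_ge0.
Qed.

Definition wave_pairing (f : V -> R[i]) : R[i] :=
  cintegral lebesgue3 setT (fun z => carrier z * f (shear z)).

Lemma cmeasurable_wave_pairing f : schwartz f ->
  cmeasurable setT (fun z : mR * mR * mR => carrier z * f (shear z)).
Proof.
move=> sf; apply: cmeasurableM; first exact: cmeasurable_carrier.
exact: cmeasurable_comp (schwartz_cmeasurable sf) measurable_shear.
Qed.

Lemma integrable_carrierM (M : R) :
  lebesgue3.-integrable setT (fun z => (gauss2 z.1 * \1_I z.2 * M)%:E).
Proof.
have := integrableZr measurableT M integrable_gauss2_circle.
exact: eq_integrable.
Qed.

Lemma cintegrable_wave_pairing f : schwartz f ->
  cintegrable lebesgue3 (fun z => carrier z * f (shear z)).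
Proof.
move=> sf; have [M M0 MP] := schwartz_bounded [::] 0 sf.
apply: (cintegrable_le (cmeasurable_wave_pairing sf) (integrable_carrierM M)) => z.
rewrite normcM normc_carrier ler_wpM2l ?gauss2_circle_ge0//.
have := MP (shear z); rewrite expr0 mul1r; apply: le_trans.
by rewrite /cpartials /=; case: (f _).
Qed.

Lemma wave_pairing_linear (c : R[i]) f g : schwartz f -> schwartz g ->
  wave_pairing (fun z => c * f z + g z) = c * wave_pairing f + wave_pairing g.
Proof.
move=> sf sg; rewrite /wave_pairing.
rewrite -(cintegral_linear c (cintegrable_wave_pairing sf) (cintegrable_wave_pairing sg)).
by apply: eq_cintegral => z _; rewrite mulrDr mulrCA.
Qed.

(** The carrier is integrable, so the supremum of the test function alone controls the pairing: the
    order is 0. *)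
Lemma wave_pairing_continuous : exists (m : nat) (C : R), forall f, schwartz f ->
  forall M : R, (forall (w : seq 'I_3) z, (size w <= m)%N ->
     weight z ^+ m * normc (cpartials w f z) <= M) ->
  normc (wave_pairing f) <= C * M.
Proof.
exists 0%N, (2 * \int[lebesgue3]_z (gauss2 z.1 * \1_I z.2))%R => f sf M MP.
rewrite -mulrA -RintegralZr//; last first.
  by have := integrable_gauss2_circle; apply: eq_integrable.
apply: normc_cintegral_le (cmeasurable_wave_pairing sf) (integrable_carrierM M) _ => z.
rewrite normcM normc_carrier ler_wpM2l ?gauss2_circle_ge0//.
have := MP [::] (shear z) isT; rewrite expr0 mul1r; apply: le_trans.
by rewrite /cpartials /=; case: (f _).
Qed.

Definition wave_distribution : tempered_distribution R :=
  TemperedDistribution wave_pairing_linear wave_pairing_continuous.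

Definition wave_fourier (w : R * R) (q : int) : R[i] :=
  gauss_hat (w.1 - a * w.2) * gauss_hat w.2 *
  (if q == n%:Z then 2 * pi else 0)%:C%C.

Lemma cmeasurable_wave_fourier q :
  cmeasurable setT (fun w : mR * mR => wave_fourier w q).
Proof.
apply: cmeasurableM; last exact: cmeasurable_cst.
apply: cmeasurableM.
- apply: (cmeasurable_comp (@cmeasurable_gauss_hat R)).
  apply: measurable_funB; first exact: measurable_fst.
  by apply: measurable_funM => //; exact: measurable_snd.
- exact: cmeasurable_comp (@cmeasurable_gauss_hat R) measurable_snd.
Qed.

(** The exponent [t tau + (x - a t) xi + y q] regroups as [t (tau - a xi) + x xi + y q], which
    leaves a product of three functions of one variable each. *)
Lemma cintegral_carrier_mode (w : R * R) (q : int) :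
  cintegral lebesgue3 setT (fun z => carrier z *
    cis (- ((shear z).1.1 * w.1 + (shear z).1.2 * w.2 + (shear z).2 * q%:~R))) =
  wave_fourier w q.
Proof.
pose g1 (x : mR) := (gauss_fun x)%:C%C * cis (- ((w.1 - a * w.2) * x)).
pose g2 (x : mR) := (gauss_fun x)%:C%C * cis (- (w.2 * x)).
pose g3 (y : mR) := ((\1_I y)%:C%C * cis (n%:R * y)) * cis (- (y * q%:~R)).
have E z : carrier z *
    cis (- ((shear z).1.1 * w.1 + (shear z).1.2 * w.2 + (shear z).2 * q%:~R)) =
    (g1 z.1.1 * g2 z.1.2) * g3 z.2.
  rewrite /carrier /gauss2 /shear /g1 /g2 /g3 /= rmorphM /=.
  rewrite (_ : - (z.1.1 * w.1 + (z.1.2 - a * z.1.1) * w.2 + z.2 * q%:~R) =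
    - ((w.1 - a * w.2) * z.1.1) + - (w.2 * z.1.2) + - (z.2 * q%:~R)); last by ring.
  by rewrite !cisD; ring.
transitivity (cintegral lebesgue3 setT (fun z => (g1 z.1.1 * g2 z.1.2) * g3 z.2)).
  by apply: eq_cintegral => z _; exact: E.
have mg3 : cmeasurable setT g3.
  apply: cmeasurableM; first exact: cmeasurable_circle_cis.
  by apply: cmeasurable_cis; apply: measurable_funN; exact: measurable_funM.
have mg12 : cmeasurable setT (fun v : mR * mR => g1 v.1 * g2 v.2).
  apply: cmeasurableM.
  - exact: cmeasurable_comp (cmeasurable_gauss_cis _) measurable_fst.
  - exact: cmeasurable_comp (cmeasurable_gauss_cis _) measurable_snd.
have ng12 v : normc (g1 v.1 * g2 v.2) <= gauss2 v.
  by rewrite normcM !normc_gauss_cis.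
have ng3 y : normc (g3 y) <= \1_I y.
  by rewrite normcM normc_circle_cis normc_cis mulr1.
rewrite (cintegral_tensor mg12 mg3 integrable_gauss2 (@integrable_circle_indic R) ng12 ng3).
rewrite (cintegral_tensor (cmeasurable_gauss_cis _) (cmeasurable_gauss_cis _)
  (@integrableT_gauss R) (@integrableT_gauss R)).
- by rewrite cintegral_circle_mode.
- by move=> x; rewrite normc_gauss_cis.
- by move=> x; rewrite normc_gauss_cis.
Qed.

Lemma schwartz2_cmeasurable (psi : R * R -> R[i]) : schwartz2 psi ->
  cmeasurable setT (psi : mR * mR -> R[i]).
Proof.
move=> /schwartz_cmeasurable mpsi.
by have := cmeasurable_comp mpsi (@pair2_measurable _ _ (mR * mR)%type mR 0).
Qed.

(** The second power of the weight is what is needed: [(1 + t^2 + x^2)^2 >= (1 + t^2) (1 + x^2)],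
    giving a majorant integrable in the plane. *)
Lemma schwartz2_le (psi : R * R -> R[i]) : schwartz2 psi -> exists M : R,
  forall w, normc (psi w) <= M * ((1 + w.1 ^+ 2)^-1 * (1 + w.2 ^+ 2)^-1).
Proof.
move=> /(schwartz_bounded [::] 2)[M M0 MP]; exists M => -[t x] /=.
have o0 (r : R) : 0 < 1 + r ^+ 2 by rewrite ltr_pwDl// sqr_ge0.
rewrite -invfM ler_pdivlMr ?mulr_gt0// mulrC.
have := MP (t, x, 0).
rewrite (_ : normc (cpartials _ _ _) = normc (psi (t, x))); last first.
  by rewrite /cpartials /=; case: (psi _).
apply: le_trans; rewrite ler_wpM2r ?normc_ge0// /weight /=.
have := sqr_ge0 t; have := sqr_ge0 x; nra.
Qed.

(** The pairing with a transform is a double integral over [z] and [w]; Fubini moves the exponential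
    from [psi] onto the carrier, whose transform is known. *)
Lemma wave_distribution_fourier : is_fourier_transform wave_fourier wave_distribution.
Proof.
move=> q; split; first exact: cmeasurable_wave_fourier.
move=> psi spsi.
have mpsi := schwartz2_cmeasurable spsi.
have [M MP] := schwartz2_le spsi.
pose h (w : mR * mR) : R := M * ((1 + w.1 ^+ 2)^-1 * (1 + w.2 ^+ 2)^-1).
have ih : lebesgue2.-integrable setT (fun w => (h w)%:E).
  have := integrableZl measurableT M
    (integrable_tensor (@integrable_oneDsqrV R) (@integrable_oneDsqrV R)).
  exact: eq_integrable.
pose e (z : V) (w : R * R) : R := - (z.1.1 * w.1 + z.1.2 * w.2 + z.2 * q%:~R).
have me : measurable_fun setT (fun zw : (mR * mR * mR) * (mR * mR) => e (shear zw.1) zw.2).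
  have ms : measurable_fun setT
      (fun zw : (mR * mR * mR) * (mR * mR) => (shear zw.1 : mR * mR * mR)).
    exact: measurableT_comp measurable_shear measurable_fst.
  have m1 : measurable_fun setT (fun z : mR * mR * mR => z.1.1).
    exact: measurableT_comp measurable_fst measurable_fst.
  have m2 : measurable_fun setT (fun z : mR * mR * mR => z.1.2).
    exact: measurableT_comp measurable_snd measurable_fst.
  apply: measurable_funN; apply: measurable_funD; [apply: measurable_funD|].
  - apply: measurable_funM; first exact: measurableT_comp m1 ms.
    exact: measurableT_comp measurable_fst measurable_snd.
  - apply: measurable_funM; first exact: measurableT_comp m2 ms.
    exact: measurableT_comp measurable_snd measurable_snd.
  - apply: measurable_funM => //; exact: measurableT_comp measurable_snd ms.
have me' z : measurable_fun setT (fun w : mR * mR => e (shear z) w).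
  exact: (measurableT_comp me (@pair1_measurable _ _ (mR * mR * mR)%type (mR * mR)%type z)).
pose k (zw : (mR * mR * mR) * (mR * mR)) : R[i] :=
  carrier zw.1 * (psi zw.2 * cis (e (shear zw.1) zw.2)).
have mk : cmeasurable setT k.
  apply: cmeasurableM; first exact: cmeasurable_comp cmeasurable_carrier measurable_fst.
  apply: cmeasurableM; first exact: cmeasurable_comp mpsi measurable_snd.
  exact: cmeasurable_cis.
have kh z w : normc (k (z, w)) <= gauss2 z.1 * \1_I z.2 * h w.
  rewrite normcM normc_carrier ler_wpM2l ?gauss2_circle_ge0//.
  by rewrite normcM normc_cis mulr1 MP.
transitivity (cintegral lebesgue3 setT (fun z => cintegral lebesgue2 setT (fun w => k (z, w)))).
  apply: eq_cintegral => z _; rewrite /k /= cintegralZl//.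
  apply: (@cintegrable_le _ _ _ _ _ h) => //.
  - by apply: cmeasurableM => //; exact: cmeasurable_cis.
  - by move=> w; rewrite normcM normc_cis mulr1 MP.
rewrite (cintegral_fubini mk integrable_gauss2_circle ih kh).
apply: eq_cintegral => w _.
rewrite -cintegral_carrier_mode mulrC -cintegralZl.
  by apply: eq_cintegral => z _; rewrite /k /= mulrCA.
apply: (cintegrable_le _ integrable_gauss2_circle).
- apply: cmeasurableM; first exact: cmeasurable_carrier.
  apply: cmeasurable_cis.
  exact: (measurableT_comp me (@pair2_measurable _ _ (mR * mR * mR)%type (mR * mR)%type w)).
- by move=> z; rewrite normcM normc_carrier normc_cis mulr1.
Qed.

End Pairing.
End WaveDistribution.

(** * The X_{s,b} norm *)

Section IntegralMono.
Local Open Scope ereal_scope.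
(** The integral of a nonnegative function is a supremum over the simple functions below it. This
    form leaves no measurability to check for the inner integral and sum of [weighted_norm]. *)
Lemma ge0_integralT_mono d (T : measurableType d) (R : realType)
    (mu : {measure set T -> \bar R}) (f g : T -> \bar R) :
  (forall x, 0 <= f x) -> (forall x, f x <= g x) ->
  \int[mu]_x f x <= \int[mu]_x g x.
Proof.
move=> f0 fg; have g0 x : 0 <= g x by exact: le_trans (fg x).
rewrite !ge0_integralTE//; apply: le_ereal_sup => _ [h hf <-].
by exists h => // x; exact: le_trans (fg x).
Qed.
End IntegralMono.

Section WaveXnorm.
Variables (R : realType) (s b : R).
Hypothesis s0 : s < 0.
Local Notation mu1 := (@lebesgue_measure R).

(** The negative sign of [s] enters here: [jap2 xi n >= n], and a negative exponent reverses the
    inequality. This is the only gain in [n]. *)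
Lemma jap2_powR_le (xi : R) (n : nat) : (0 < n)%N ->
  jap2 xi n%:R `^ (2 * s) <= n%:R `^ (2 * s).
Proof.
move=> n0; have n1 : 0 < n%:R :> R by rewrite ltr0n.
have nj : n%:R <= jap2 xi n%:R :> R.
  rewrite /jap2 -[leLHS]ger0_norm// -sqrtr_sqr ler_sqrt; first by rewrite lerDr addr_ge0// sqr_ge0.
  by rewrite !addr_ge0// sqr_ge0.
have -> : 2 * s = - (2 * - s) by rewrite mulrN opprK.
have j0 := lt_le_trans n1 nj.
have p0 : 0 <= 2 * - s by rewrite mulr_ge0// oppr_ge0 ltW.
rewrite !powRN lef_pV2 ?posrE ?powR_gt0//.
by apply: ge0_ler_powR => //; rewrite nnegrE ltW.
Qed.

(** Since [jap x >= 1], the exponent can be raised to the even integer [2 k], whatever the sign of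
    [b]. *)
Lemma jap_powR_le (x : R) (k : nat) : `|b| <= k%:R ->
  jap x `^ (2 * b) <= (1 + x ^+ 2) ^+ k.
Proof.
move=> bk.
have j1 : 1 <= jap x by rewrite /jap -[leLHS]sqrtr1 ler_sqrt ?lerDl ?sqr_ge0// addr_ge0// sqr_ge0.
apply: (@le_trans _ _ (jap x `^ (2 * k%:R))).
  by apply: ler_powR => //; rewrite ler_pM2l// (le_trans (ler_norm _)).
by rewrite -natrM powR_mulrn ?(le_trans ler01)// exprM sqr_sqrtr// addr_ge0// sqr_ge0.
Qed.

(** A Peetre-type inequality, from [(x - y^3)^2 <= 2 x^2 + 2 y^6] and [y^6 <= (1 + y^2)^3]; it
    separates the modulation [sg - xi^3] into a factor in [sg] and one in [xi]. *)
Lemma oneDsqrB_le (x y : R) :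
  1 + (x - y ^+ 3) ^+ 2 <= 2 * ((1 + x ^+ 2) * (1 + y ^+ 2) ^+ 3).
Proof.
have X := sqr_ge0 x; have Y := sqr_ge0 y.
have A : 1 <= (1 + y ^+ 2) ^+ 3 by rewrite exprn_ege1// lerDl.
have B : y ^+ 6 <= (1 + y ^+ 2) ^+ 3.
  by rewrite (exprM y 2 3) lerXn2r ?nnegrE ?addr_ge0// lerDr.
have C : (x - y ^+ 3) ^+ 2 <= 2 * x ^+ 2 + 2 * y ^+ 6.
  by rewrite (exprM y 3 2); have := sqr_ge0 (x + y ^+ 3); nra.
have D : 0 <= (1 + y ^+ 2) ^+ 3 - 1 by rewrite subr_ge0.
have := mulr_ge0 X D.
rewrite mulrBr mulr1 => E; rewrite mulrDl mul1r.
have F : 1 + (y ^+ 2) * 3 + y ^+ 6 <= (1 + y ^+ 2) ^+ 3.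
  rewrite (exprM y 2 3) [leRHS](_ : _ = 1 + y ^+ 2 * 3 + 3 * (y ^+ 2) ^+ 2 + (y ^+ 2) ^+ 3);
    last by ring.
  by rewrite lerD2r lerDl mulr_ge0// sqr_ge0.
lra.
Qed.

Lemma wave_fourier_decay : exists2 B : R, 0 <= B & forall (n : nat) (tau xi : R),
  (0 < n)%N ->
  jap2 xi n%:R `^ (2 * s) * jap (tau - phase xi n) `^ (2 * b) *
    normc (wave_fourier (n%:R ^+ 2) n (tau, xi) n) ^+ 2 <=
  n%:R `^ (2 * s) * B *
    (1 + xi ^+ 2)^-1 * (1 + (tau - n%:R ^+ 2 * xi) ^+ 2)^-1.
Proof.
pose k := (Num.truncn `|b|).+1.
have bk : `|b| <= k%:R by rewrite ltW// truncnS_gt.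
(* The powers [k] and [3 k] absorb the modulation weight; the extra one in each transform leaves the
   integrable factors [(1 + sg^2)^-1] and [(1 + xi^2)^-1]. *)
have [K1 K10 K1P] := @gauss_hat_decay R k.+1.
have [K2 K20 K2P] := @gauss_hat_decay R (3 * k).+1.
have P2 : 0 <= 2 ^+ k * (2 * pi) ^+ 2 :> R by rewrite mulr_ge0 ?exprn_ge0// ltW// twopi_gt0.
exists (2 ^+ k * (2 * pi) ^+ 2 * (K1 * K2)) => [|n tau xi n0];
  first exact: mulr_ge0 P2 (mulr_ge0 K10 K20).
set sg := tau - n%:R ^+ 2 * xi.
have o0 (x : R) : 0 < 1 + x ^+ 2 by rewrite ltr_pwDl// sqr_ge0.
have -> : tau - phase xi n = sg - xi ^+ 3.
  by rewrite /phase /sg -pmulrn; ring.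
pose G1 := normc (gauss_hat sg); pose G2 := normc (gauss_hat xi).
have -> : normc (wave_fourier (n%:R ^+ 2) n (tau, xi) n) = G1 * G2 * (2 * pi).
  by rewrite /wave_fourier eqxx !normcM normc_real (ger0_norm (ltW (@twopi_gt0 R))).
have G10 : 0 <= G1 by exact: normc_ge0.
have G20 : 0 <= G2 by exact: normc_ge0.
have {}K1P : (1 + sg ^+ 2) ^+ k.+1 * G1 ^+ 2 <= K1 by exact: K1P.
have {}K2P : (1 + xi ^+ 2) ^+ (3 * k).+1 * G2 ^+ 2 <= K2 by exact: K2P.
move: G1 G2 G10 G20 K1P K2P => G1 G2 G10 G20 K1P K2P.
have J : jap (sg - xi ^+ 3) `^ (2 * b) <= 2 ^+ k * ((1 + sg ^+ 2) ^+ k * (1 + xi ^+ 2) ^+ (3 * k)).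
  rewrite (le_trans (jap_powR_le _ bk))// exprM -!exprMn lerXn2r ?nnegrE ?oneDsqrB_le// ltW//.
  by rewrite !mulr_gt0// exprn_gt0.
have E1 : (1 + sg ^+ 2) ^+ k * G1 ^+ 2 <= K1 * (1 + sg ^+ 2)^-1.
  by rewrite ler_pdivlMr// mulrAC -exprSr K1P.
have E2 : (1 + xi ^+ 2) ^+ (3 * k) * G2 ^+ 2 <= K2 * (1 + xi ^+ 2)^-1.
  by rewrite ler_pdivlMr// mulrAC -exprSr K2P.
have E3 : (1 + sg ^+ 2) ^+ k * G1 ^+ 2 * ((1 + xi ^+ 2) ^+ (3 * k) * G2 ^+ 2) <=
    K1 * (1 + sg ^+ 2)^-1 * (K2 * (1 + xi ^+ 2)^-1).
  by apply: ler_pM; rewrite // mulr_ge0 ?sqr_ge0// exprn_ge0// ltW.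
rewrite -[leLHS]mulrA [leRHS](_ : _ = n%:R `^ (2 * s) *
  (2 ^+ k * (2 * pi) ^+ 2 * (K1 * (1 + sg ^+ 2)^-1 * (K2 * (1 + xi ^+ 2)^-1)))); last by ring.
apply: ler_pM; [exact: powR_ge0| |exact: jap2_powR_le|].
  by rewrite mulr_ge0 ?powR_ge0 ?sqr_ge0.
apply: le_trans (ler_wpM2r (sqr_ge0 _) J) _.
rewrite [leLHS](_ : _ = 2 ^+ k * (2 * pi) ^+ 2 * ((1 + sg ^+ 2) ^+ k * G1 ^+ 2 *
  ((1 + xi ^+ 2) ^+ (3 * k) * G2 ^+ 2))); last by ring.
exact: ler_wpM2l P2 _ _ E3.
Qed.

Lemma wave_Xnorm : exists2 B : R, 0 <= B & forall n : nat, (0 < n)%N ->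
  (Xnorm s b (wave_distribution (n%:R ^+ 2) n) <= ((n%:R `^ (2 * s) * B) `^ 2^-1)%:E)%E.
Proof.
have [B B0 BP] := wave_fourier_decay.
(* One factor pi for each of the integrals in [tau] and [xi]. *)
exists (B * (pi * pi)) => [|n n0]; first by rewrite !mulr_ge0// pi_ge0.
apply: le_trans (_ : weighted_norm s b (wave_fourier (n%:R ^+ 2) n) <= _)%E.
  by apply: ereal_inf_lbound; exists (wave_fourier (n%:R ^+ 2) n) => //;
    exact: wave_distribution_fourier.
rewrite /weighted_norm -poweR_EFin.
have o0 (x : R) : 0 < 1 + x ^+ 2 by rewrite ltr_pwDl// sqr_ge0.
pose T (xi tau : R) (q : int) := ((jap2 xi q%:~R `^ (2 * s) * jap (tau - phase xi q) `^ (2 * b) *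
         normc (wave_fourier (n%:R ^+ 2) n (tau, xi) q) ^+ 2)%R%:E : \bar R).
have T0 xi tau q : (0 <= T xi tau q)%E.
  by rewrite lee_fin mulr_ge0 ?sqr_ge0// mulr_ge0 ?powR_ge0.
(* Only the mode [q = n] is charged, so the sum collapses to one term. *)
have TE xi tau : \esum_(q in [set: int]) T xi tau q = T xi tau n%:Z.
  rewrite -[RHS](@esum_set1 R _ n%:Z (T xi tau))// [RHS]esum_mkcond.
  apply: eq_esum => q _; case: ifPn => //; rewrite notin_setE /= => /eqP qn.
  by rewrite /T /wave_fourier (negPf qn) normcM normc_real normr0 mulr0 expr0n mulr0.
pose D : R := n%:R `^ (2 * s) * B.
have D0 : 0 <= D by rewrite mulr_ge0 ?powR_ge0.
have I1 xi : (\int[mu1]_tau (\esum_(q in [set: int]) T xi tau q) <=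
    (D * pi)%:E * ((1 + xi ^+ 2)^-1)%:E)%E.
  apply: (@le_trans _ _ (\int[mu1]_tau ((D * (1 + xi ^+ 2)^-1)%:E *
      ((1 + (tau - n%:R ^+ 2 * xi) ^+ 2)^-1)%:E))%E).
    apply: ge0_integralT_mono => tau; first by apply: esum_ge0 => q _; exact: T0.
    by rewrite TE -EFinM lee_fin; exact: BP.
  (* Translating [tau] by [n^2 xi] makes this integral equal to pi for all [n] and [xi], so no
     dependence on the shear survives. *)
  have S := @ge0_integral_shift R (fun x => (1 + x ^+ 2)^-1) (- (n%:R ^+ 2 * xi))
    (@continuous_oneDsqrV R) (fun x => ltW (etrans (invr_gt0 _) (o0 x))).
  rewrite ge0_integralZl//; last 3 first.
  - apply/measurable_EFinP; apply: (measurableT_comp (@measurable_oneDsqrV R)).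
    exact: measurable_funB.
  - by move=> tau _; rewrite lee_fin invr_ge0 ltW.
  - by rewrite lee_fin mulr_ge0// invr_ge0 ltW.
  by rewrite S integral_oneDsqrV -!EFinM lee_fin mulrAC.
apply: gt0_ler_poweR; rewrite ?invr_ge0 ?in_itv /= ?leey ?andbT//.
- by apply: integral_ge0 => xi _; apply: integral_ge0 => tau _; apply: esum_ge0 => q _; exact: T0.
- by rewrite lee_fin !mulr_ge0 ?powR_ge0 ?pi_ge0.
apply: (@le_trans _ _ (\int[mu1]_xi ((D * pi)%:E * ((1 + xi ^+ 2)^-1)%:E))%E).
  apply: ge0_integralT_mono => xi; last exact: I1.
  by apply: integral_ge0 => tau _; apply: esum_ge0 => q _; exact: T0.
rewrite ge0_integralZl//; last 3 first.
- by apply/measurable_EFinP; exact: measurable_oneDsqrV.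
- by move=> xi _; rewrite lee_fin invr_ge0 ltW.
- by rewrite lee_fin mulr_ge0// pi_ge0.
by rewrite integral_oneDsqrV -EFinM lee_fin /D !mulrA.
Qed.

End WaveXnorm.

(** * The L^4 norm *)

Section L4Bound.
Variable R : realType.
Local Notation mR := (measurableTypeR R).
Local Notation mu1 := (@lebesgue_measure R).
Local Notation V := (R * R * R)%type.
Local Notation I := (`[0, 2 * pi[%classic : set R).

(** The integral of [|u_n|^2] over the slab in sheared variables, hence independent of the shear and
    of [n]. *)
Definition wave_mass : R := (\int[@lebesgue3 R]_z (gauss2 z.1 ^+ 2 * \1_I z.2))%R.

(** Finite because [0 <= g <= 1] gives [g^2 <= g], and positive because [g >= exp (- 1)] on
    [[0, 1]]. *)
Lemma integral_gauss_sqr : exists2 c : R, 0 < c &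
  (\int[mu1]_x (gauss_fun x ^+ 2)%:E = c%:E)%E.
Proof.
have mg2 : measurable_fun setT (fun x : R => gauss_fun x ^+ 2).
  by apply: measurable_funX; exact: measurable_gauss_fun.
have ub : (\int[mu1]_x (gauss_fun x ^+ 2)%:E < +oo)%E.
  apply: (@le_lt_trans _ _ (\int[mu1]_x (gauss_fun x)%:E)%E);
    last by rewrite integralT_gauss ltry.
  apply: ge0_integralT_mono => x; rewrite lee_fin ?sqr_ge0// expr2.
  by rewrite ler_piMl ?gauss_fun_ge0 ?gauss_fun_le1.
pose J : set R := `[0, 1]%classic.
have lb : ((expR (- 1) ^+ 2)%:E <= \int[mu1]_x (gauss_fun x ^+ 2)%:E)%E.
  apply: (@le_trans _ _ (\int[mu1]_x ((expR (- 1) ^+ 2)%:E * (\1_J x)%:E))%E).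
    have mJ : measurable_fun setT (fun x => (\1_J x)%:E : \bar R).
      by apply/measurable_EFinP; apply: measurable_indic; exact: measurable_itv.
    have J0 x : setT x -> (0 <= (\1_J x)%:E :> \bar R)%E by rewrite lee_fin.
    have e0 : (0 <= (expR (- 1) ^+ 2)%:E :> \bar R)%E by rewrite lee_fin sqr_ge0.
    rewrite (ge0_integralZl mu1 measurableT mJ J0 e0).
    rewrite integral_indic//= ?setIT; last exact: measurable_itv.
    by rewrite lebesgue_measure_itv /= lte_fin ltr01 oppr0 adde0 mule1.
  apply: ge0_integralT_mono => x; first by rewrite lee_fin mulr_ge0 ?sqr_ge0.
  rewrite lee_fin indicE; have [/set_mem|_] := boolP (x \in J); last by rewrite mulr0 sqr_ge0.
  rewrite /J /= in_itv /= => /andP[x0 x1]; rewrite mulr1.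
  rewrite lerXn2r ?nnegrE ?expR_ge0// ?gauss_fun_ge0// /gauss_fun ler_expR lerN2.
  by rewrite expr_le1.
exists (fine (\int[mu1]_x (gauss_fun x ^+ 2)%:E)%E).
  by apply: fine_gt0; rewrite ub andbT (lt_le_trans _ lb)// lte_fin exprn_gt0// expR_gt0.
rewrite fineK// ge0_fin_numE//.
by apply: integral_ge0 => x _; rewrite lee_fin sqr_ge0.
Qed.

Lemma wave_mass_gt0 : 0 < wave_mass.
Proof.
have [c c0 cE] := integral_gauss_sqr.
have mg2 : measurable_fun setT (fun x : mR => gauss_fun x ^+ 2).
  by apply: measurable_funX; exact: measurable_gauss_fun.
have E : (\int[@lebesgue3 R]_z (gauss2 z.1 ^+ 2 * \1_I z.2)%:E = (c * c * (2 * pi))%:E)%E.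
  rewrite (@ge0_integral_tensor _ _ _ _ _ (@lebesgue2 R) mu1
      (fun w => gauss2 w ^+ 2) (fun y => \1_I y))//.
  - under [X in (X * _)%E]eq_integral do rewrite /gauss2 exprMn.
    rewrite (@ge0_integral_tensor _ _ _ _ _ mu1 mu1
      (fun x => gauss_fun x ^+ 2) (fun x => gauss_fun x ^+ 2))//.
    + rewrite cE integral_indic//= setIT lebesgue_measure_itv /= lte_fin twopi_gt0.
      by rewrite oppr0 adde0.
    + by move=> x; exact: sqr_ge0.
    + by move=> x; exact: sqr_ge0.
  - by apply: measurable_funX; exact: measurable_gauss2.
  - by apply: measurable_indic; exact: measurable_itv.
  - by move=> w; exact: sqr_ge0.
by rewrite /wave_mass /Rintegral E /= !mulr_gt0// pi_gt0.
Qed.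

(* An elementary substitute for Hoelder's inequality with exponents 4 and 4/3. *)
Lemma mul_le_quartic (G F e : R) : 0 < e -> 0 <= G -> 0 <= F -> F <= 1 ->
  G * F <= e * F + e ^- 3 * G ^+ 4.
Proof.
move=> e0 G0 F0 F1.
have q0 : 0 <= e ^- 3 * G ^+ 4 by rewrite mulr_ge0// ?invr_ge0 exprn_ge0// ltW.
have [Ge|eG] := lerP G e; first by rewrite (le_trans (ler_wpM2r F0 Ge))// lerDl.
rewrite (@le_trans _ _ G)//; first by rewrite ler_piMr.
rewrite (@le_trans _ _ (e ^- 3 * G ^+ 4))//; last by rewrite lerDr mulr_ge0// ltW.
rewrite mulrC ler_pdivlMr ?exprn_gt0// (exprS G 3) ler_wpM2l//.
by rewrite lerXn2r ?nnegrE// ltW.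
Qed.

Section Test.
Variables (a : R) (n : nat).

Lemma test_wave_shear z : test_wave a n (shear a z) =
  (gauss2 z.1)%:C%C * cis (- (n%:R * z.2)).
Proof.
rewrite /test_wave /wave /gauss2 /shear /= subrK -!gauss_pgauss addr0 cosDpihalf.
by apply/eqP; rewrite eq_complex /= !mul0r subr0 addr0 cosN sinN !eqxx.
Qed.

Lemma wave_pairing_test : wave_pairing a n (test_wave a n) = wave_mass%:C%C.
Proof.
transitivity (cintegral (@lebesgue3 R) setT
    (fun z => (gauss2 z.1 ^+ 2 * \1_I z.2)%:C%C)).
  apply: eq_cintegral => z _; rewrite test_wave_shear /carrier.
  have E : cis (n%:R * z.2) * cis (- (n%:R * z.2)) = 1 :> R[i].
    by rewrite -cisD subrr /cis cos0 sin0.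
  rewrite mulrACA -[(_ * cis _) * cis _]mulrA E mulr1 -!rmorphM /=.
  by rewrite expr2.
rewrite /cintegral /=; congr (_ +i* _)%C.
by rewrite /Rintegral integral0.
Qed.

Lemma normc_test_wave (z : V) : normc (test_wave a n z) =
  gauss_fun z.1.1 * gauss_fun (z.1.2 + a * z.1.1).
Proof.
case: z => -[t x] y.
have E : shear a (t, x + a * t, y) = (t, x, y) by rewrite /shear /= addrK.
rewrite -{1}E test_wave_shear.
by rewrite normcM normc_cis mulr1 normc_real ger0_norm ?gauss2_ge0.
Qed.

(** For fixed [t] a translation in [x] removes the shear; the two Gaussians give [sqrt pi] each and
    the circle [2 pi]. *)
Lemma integral_sheared_gauss2 :
  (\int[@lebesgue3 R]_z (gauss_fun z.1.1 * gauss_fun (z.1.2 + a * z.1.1) * \1_I z.2)%:E =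
   (2 * pi ^+ 2)%:E)%E.
Proof.
have mg : measurable_fun setT (fun w : mR * mR => gauss_fun w.1 * gauss_fun (w.2 + a * w.1)).
  apply: measurable_funM; first exact: measurableT_comp measurable_gauss_fun measurable_fst.
  apply: (measurableT_comp (@measurable_gauss_fun R)).
  by apply: measurable_funD; [exact: measurable_snd|];
    apply: measurable_funM; [|exact: measurable_fst].
have g0 (w : mR * mR) : 0 <= gauss_fun w.1 * gauss_fun (w.2 + a * w.1).
  by rewrite mulr_ge0 ?gauss_fun_ge0.
rewrite (@ge0_integral_tensor _ _ _ _ _ (@lebesgue2 R) mu1
      (fun w => gauss_fun w.1 * gauss_fun (w.2 + a * w.1)) (fun y => \1_I y))//.
rewrite (_ : (\int[@lebesgue2 R]_w _)%E = pi%:E); last first.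
  rewrite (@fubini_tonelli1 _ _ _ _ _ mu1 mu1); last 2 first.
  - exact/measurable_EFinP.
  - by move=> w; rewrite lee_fin.
  rewrite /fubini_F /=.
  transitivity (\int[mu1]_x ((gauss_fun x)%:E * (Num.sqrt pi)%:E))%E.
    apply: eq_integral => x _; rewrite -integralT_gauss.
    rewrite -(@ge0_integral_shift R _ (a * x) (@continuous_gauss_fun R) (@gauss_fun_ge0 R)).
    rewrite -ge0_integralZl ?lee_fin ?gauss_fun_ge0//.
    - apply/measurable_EFinP; apply: (measurableT_comp (@measurable_gauss_fun R)).
      exact: measurable_funD.
    - by move=> y _; rewrite lee_fin gauss_fun_ge0.
  rewrite ge0_integralZr ?lee_fin ?sqrtr_ge0//.
  - by rewrite integralT_gauss -EFinM -expr2 sqr_sqrtr// pi_ge0.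
  - by apply/measurable_EFinP; exact: measurable_gauss_fun.
  - by move=> y _; rewrite lee_fin gauss_fun_ge0.
  rewrite integral_indic//= setIT lebesgue_measure_itv /= lte_fin twopi_gt0.
  by rewrite oppr0 adde0 -EFinM; congr EFin; ring.
by apply: measurable_indic; exact: measurable_itv.
Qed.

Lemma slab_indic (z : V) : \1_(@slab R) z = \1_I z.2 :> R.
Proof.
by rewrite !indicE (_ : (z \in @slab R) = (z.2 \in I)).
Qed.

Lemma measurable_slab : measurable (@slab R : set (mR * mR * mR)).
Proof.
rewrite (_ : @slab R = setT `*` I).
  by apply: measurableX => //; exact: measurable_itv.
by apply/seteqP; split=> z /=; rewrite in_itv /=; [|case].
Qed.

(** For every representative [g], the mass [K] is the integral of [g] against the conjugate wave, so
    with [S] the modulus of the wave on the slab, [K] is at most twice the integral of [|g| S],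
    hence at most [2 (2 pi^2 e + e^-3 L)], where [L] is the integral of [|g|^4]. *)
Lemma L4norm_wave_ge (e : R) : e = wave_mass / (8 * pi ^+ 2) ->
  (((wave_mass * e ^+ 3 / 4) `^ 4^-1)%:E <= L4norm (wave_distribution a n))%E.
Proof.
set K := wave_mass; have K0 : 0 < K := wave_mass_gt0.
have pi2 : 0 < pi ^+ 2 :> R by rewrite exprn_gt0// pi_gt0.
move=> eE; have e0 : 0 < e by rewrite eE divr_gt0// mulr_gt0.
apply/ereal_infP => _ [g [mg gP] <-].
rewrite -poweR_EFin; apply: gt0_ler_poweR; rewrite ?invr_ge0 ?in_itv /= ?leey ?andbT//.
- by rewrite lee_fin divr_ge0// mulr_ge0 ?exprn_ge0 ?ltW.
- by apply: integral_ge0 => z _; rewrite lee_fin exprn_ge0 ?normc_ge0.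
(* A representative is controlled on the slab only; extending it by zero gives a function measurable
   on the whole space. *)
pose gs (z : mR * mR * mR) : R[i] := (\1_(@slab R) z)%:C%C * g z.
have mgs : cmeasurable setT gs.
  have [mr mi] := mg; split.
  - rewrite (_ : (fun z => _) = (fun z => complex.Re (g z)) \_ (@slab R)).
      by apply: (measurable_restrictT _ measurable_slab).1; exact: mr.
    apply/funext => z; rewrite patchE /gs indicE.
    by case: ifP => _; case: (g z) => u v /=; rewrite ?mul1r ?mul0r subr0.
  - rewrite (_ : (fun z => _) = (fun z => complex.Im (g z)) \_ (@slab R)).
      by apply: (measurable_restrictT _ measurable_slab).1; exact: mi.
    apply/funext => z; rewrite patchE /gs indicE.
    by case: ifP => _; case: (g z) => u v /=; rewrite ?mul1r ?mul0r addr0.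
have mn4 : measurable_fun setT (fun z => normc (gs z) ^+ 4).
  by apply: measurable_funX; exact: cmeasurable_normc.
have -> : (\int[mu1 \x mu1 \x mu1]_(z in @slab R) (normc (g z) ^+ 4)%:E =
    \int[@lebesgue3 R]_z (normc (gs z) ^+ 4)%:E)%E.
  rewrite integral_mkcond; apply: eq_integral => z _.
  rewrite patchE /gs normcM normc_real indicE.
  by case: ifP => _; rewrite ?normr1 ?mul1r// normr0 mul0r expr0n.
set L := (\int[_]_z _)%E.
have [Loo|] := eqVneq L +oo%E; first by rewrite Loo leey.
move=> /negP/negP; rewrite -ltey => Ly.
have L0 : (0 <= L)%E by apply: integral_ge0 => z _; rewrite lee_fin exprn_ge0 ?normc_ge0.
have i4 : (@lebesgue3 R).-integrable setT (fun z => (normc (gs z) ^+ 4)%:E).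
  apply/integrableP; split; first exact/measurable_EFinP.
  under eq_integral => z _ do rewrite gee0_abs ?lee_fin ?exprn_ge0 ?normc_ge0//.
  exact: Ly.
pose S (z : V) : R := gauss_fun z.1.1 * gauss_fun (z.1.2 + a * z.1.1) * \1_I z.2.
have S0 z : 0 <= S z by rewrite !mulr_ge0 ?gauss_fun_ge0.
have mtw := schwartz_cmeasurable (schwartz_test_wave a n).
have mS : measurable_fun setT (S : mR * mR * mR -> R).
  rewrite (_ : S = fun z => normc (test_wave a n z) * \1_(@slab R) z).
    apply: measurable_funM; first exact: cmeasurable_normc.
    exact: measurable_indic measurable_slab.
  by apply/funext => z; rewrite /S normc_test_wave slab_indic.
have iS : (@lebesgue3 R).-integrable setT (fun z => (S z)%:E).
  apply/integrableP; split; first exact/measurable_EFinP.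
  under eq_integral => z _ do rewrite gee0_abs ?lee_fin ?S0//.
  by rewrite integral_sheared_gauss2 ltry.
pose h z := e * S z + e ^- 3 * normc (gs z) ^+ 4.
have ih : (@lebesgue3 R).-integrable setT (fun z => (h z)%:E).
  have := integrableD measurableT (integrableZl measurableT e iS)
    (integrableZl measurableT (e ^- 3) i4).
  exact: eq_integrable.
have mgt : cmeasurable setT (fun z => gs z * test_wave a n z) by exact: cmeasurableM.
have le_h z : normc (gs z * test_wave a n z) <= h z.
  rewrite normcM normc_test_wave /h /S.
  have -> : normc (gs z) * (gauss_fun z.1.1 * gauss_fun (z.1.2 + a * z.1.1)) =
      normc (gs z) * (gauss_fun z.1.1 * gauss_fun (z.1.2 + a * z.1.1) * \1_I z.2).
    rewrite -slab_indic /gs normcM normc_real ger0_norm// indicE.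
    by case: (z \in _); rewrite ?mulr1// !mul0r.
  apply: mul_le_quartic; rewrite ?normc_ge0 ?S0//.
  rewrite mulr_ile1 ?mulr_ge0 ?gauss_fun_ge0//.
  by rewrite mulr_ile1 ?gauss_fun_ge0 ?gauss_fun_le1.
have := normc_cintegral_le mgt ih le_h.
have <- : wave_pairing a n (test_wave a n) =
    cintegral (@lebesgue3 R) setT (fun z => gs z * test_wave a n z).
  have := gP _ (schwartz_test_wave a n); rewrite /= => ->.
  rewrite cintegral_mkcond; apply: eq_cintegral => z _.
  by rewrite /gs mulrA.
rewrite wave_pairing_test normc_real (gtr0_norm K0).
have -> : (\int[@lebesgue3 R]_z h z = e * (2 * pi ^+ 2) + e ^- 3 * fine L)%R.
  rewrite /h RintegralD//; last 2 first.
  - by have := integrableZl measurableT e iS; apply: eq_integrable.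
  - by have := integrableZl measurableT (e ^- 3) i4; apply: eq_integrable.
  rewrite !RintegralZl//.
  by rewrite {1}/Rintegral integral_sheared_gauss2.
have LE : L = (fine L)%:E by rewrite fineK// ge0_fin_numE.
rewrite [X in (_ <= X)%E]LE lee_fin.
(* The value of [e] is chosen so that, after the factor 2, this term takes up half of [K]; what
   remains gives [K / 4 <= e^-3 L]. *)
have -> : e * (2 * pi ^+ 2) = K / 4.
  by rewrite eE; move: (pi ^+ 2) (lt0r_neq0 pi2) => P P0; field.
move=> KL.
have e3 : 0 < e ^+ 3 by rewrite exprn_gt0.
have {}KL : K / 4 <= e ^- 3 * fine L by lra.
rewrite -mulrA mulrCA mulrC -ler_pdivlMr//.
by rewrite [leRHS]mulrC.
Qed.

End Test.
End L4Bound.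

(** * Contradiction as the mode n grows *)

Theorem proposition3p10 (R : realType) (s b : R) (hs : s < 0) :
  ~ exists C : R, forall u : tempered_distribution R,
      Xsb s b u -> (L4norm u <= C%:E * Xnorm s b u)%E.
Proof.
move=> [C HC].
have [B B0 BP] := wave_Xnorm b hs.
set D := (wave_mass R * (wave_mass R / (8 * pi ^+ 2)) ^+ 3 / 4) `^ 4^-1.
have D0 : 0 < D.
  have K0 := wave_mass_gt0 R.
  have e0 : 0 < wave_mass R / (8 * pi ^+ 2).
    by rewrite divr_gt0// mulr_gt0// exprn_gt0// pi_gt0.
  by rewrite powR_gt0// divr_gt0// mulr_gt0// exprn_gt0.
pose B' := B `^ 2^-1.
(* The square root turns [n^(2 s) B] into [n^s B']. The constant [C] carries no sign, hence its
   absolute value. *)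
have bound n : (0 < n)%N -> D <= `|C| * B' * n%:R `^ s.
  move=> n0; have Xn := BP n n0.
  set u := wave_distribution (n%:R ^+ 2) n in Xn.
  have X0 : (0 <= Xnorm s b u)%E.
    by apply/ereal_infP => _ [F _ <-]; exact: poweR_ge0.
  have Xfin : (Xnorm s b u < +oo)%E by apply: le_lt_trans Xn _; rewrite ltry.
  have := le_trans (L4norm_wave_ge (n%:R ^+ 2) n erefl) (HC u Xfin).
  rewrite -/D; move: Xn; rewrite -(@fineK _ (Xnorm s b u)) ?ge0_fin_numE//.
  rewrite -EFinM !lee_fin powRM ?powR_ge0// -powRrM mulrAC divff// mul1r -/B' => Xn DC.
  rewrite (le_trans DC)// -mulrA (le_trans (ler_wpM2r _ (ler_norm C))) ?fine_ge0//.
  by rewrite ler_wpM2l// mulrC.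
(* Chosen so that [D Y = |C| B' + D]. An [n] with [n^(- s) >= Y] then contradicts
   [D n^(- s) <= |C| B']. *)
pose Y := `|C| * B' / D + 1.
have Y0 : 0 < Y by rewrite ltr_wpDl// divr_ge0 ?(ltW D0)// mulr_ge0// powR_ge0.
pose n := (Num.truncn (Y `^ (- s)^-1)).+1.
have nY : Y <= n%:R `^ (- s).
  have s'0 : 0 < - s by rewrite oppr_gt0.
  have YE : (Y `^ (- s)^-1) `^ (- s) = Y.
    by rewrite -powRrM mulVf ?lt0r_neq0// powRr1// ltW.
  rewrite -[leLHS]YE; apply: ge0_ler_powR; rewrite ?nnegrE ?powR_ge0//; first exact: ltW.
  by rewrite ltW// truncnS_gt.
have n0 : 0 < n%:R `^ s by rewrite powR_gt0.
have := bound n isT; rewrite -ler_pdivrMr// -[(_ `^ s)^-1]powRN => Dn.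
have := le_trans (ler_wpM2l (ltW D0) nY) Dn.
by rewrite /Y mulrDr mulr1 mulrC divfK ?gt_eqF// gerDl leNgt D0.
Qed.
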